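(* Let $\Omega\subseteq\mathbb{C}$ be a domain, $F:\Omega\to B(\mathfrak{X})$ a function, $\mathcal{H}=\mathcal{H}_F$ the associated reproducing kernel Hilbert space, $\{u_n\}_{n\ge1}$ an orthonormal basis of $\mathfrak{X}$, and $F_n(z)=F(z)u_n$ for $z\in\Omega$. Then every element of $\mathcal{H}$ is an $\mathfrak{X}$-valued analytic function on $\Omega$ if and only if each $F_n$ is analytic on $\Omega$ and $z\mapsto\|F(z)\|$ is bounded on every compact subset of $\Omega$.
   Context: $\mathfrak{X}$ is a complex separable Hilbert space. $\mathcal{H}_F=\{f_u: u\in\mathfrak{X}\}$ with $f_u(z)=F(z)u$, normed by $\|f_u\|=\inf\{\|w\|_{\mathfrak{X}}: F(\cdot)w=f_u\}$. *)

(* Defs.v *)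
From HB Require Import structures.
From mathcomp Require Import all_boot all_order all_algebra.
From mathcomp Require Import all_classical all_reals all_analysis.
From mathcomp Require Import complex.
Set Implicit Arguments. Unset Strict Implicit. Unset Printing Implicit Defensive.
Import Order.TTheory GRing.Theory Num.Theory.
Import numFieldNormedType.Exports.
Local Open Scope classical_set_scope.
Local Open Scope ring_scope.

(* The complex numbers are [R[i]] (mathcomp-real-closed) for [R : realType];
   they carry their numFieldType normed/topological structure. *)

(* The complex plane as a normed space over itself. *)
Notation Cplx R := (R[i])^o.

(* A domain: nonempty, open, connected subset of C. *)
Definition is_domain (R : realType) (Om : set (Cplx R)) : Prop :=
  Om !=set0 /\ open Om /\ connected Om.

(* Inner product on a complex normed space inducing its norm:
   linear in the first argument, conjugate symmetric, <x,x> = ||x||^2. *)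
Definition is_inner_product (R : realType) (X : normedModType R[i])
  (ip : X -> X -> R[i]) : Prop :=
  (forall (a : R[i]) (x y z : X), ip (a *: x + y) z = a * ip x z + ip y z) /\
  (forall x y : X, ip y x = (ip x y)^*) /\
  (forall x : X, ip x x = `|x| ^+ 2).

(* {u_n} is an orthonormal basis: orthonormal and complete (maximal). *)
Definition is_orthonormal_basis (R : realType) (X : normedModType R[i])
  (ip : X -> X -> R[i]) (u : nat -> X) : Prop :=
  (forall m n : nat, ip (u m) (u n) = (m == n)%:R) /\
  (forall x : X, (forall n, ip x (u n) = 0) -> x = 0).

(* T is a bounded linear operator on X, i.e. an element of B(X). *)
Definition is_bounded_operator (R : realType) (X : normedModType R[i])
  (T : X -> X) : Prop :=
  (forall (a : R[i]) (x y : X), T (a *: x + y) = a *: T x + T y) /\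
  exists M : R, forall x : X, `|T x| <= (M%:C)%C * `|x|.

(* ||T|| <= M for a (bounded) operator T (operator norm). *)
Definition opnorm_le (R : realType) (X : normedModType R[i])
  (T : X -> X) (M : R) : Prop :=
  forall x : X, `|T x| <= (M%:C)%C * `|x|.

(* f : Omega -> X is (complex) analytic = holomorphic: complex
   differentiable at every point of Omega. *)
Definition analytic_on (R : realType) (X : normedModType R[i])
  (Om : set (Cplx R)) (f : Cplx R -> X) : Prop :=
  forall z : Cplx R, Om z -> derivable f z (1 : Cplx R).

(* Main.v *)
(* A vector-valued form of Goursat's theorem, with midpoint Riemann sums instead
   of integrals: the sum over the boundary of a square with 2^(n+1) cells per side
   is exactly the sum over its four quarters with 2^n cells per side, so the usual
   nested-squares argument shows that the boundary sums of a complex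
   differentiable f tend to 0.  Applied to f(z) / z^2 on the annuli between
   concentric squares, this gives the Cauchy estimate |f'(0)| <= 2 B / s; the
   mean value inequality then yields the Taylor bound
   |f(a + h) - f(a) - h f'(a)| <= C |h|^2 with C depending only on a bound of f
   near a, and such a bound passes to locally uniform limits.

   If the norms of F are bounded on compact sets, F(.) w is the locally uniform
   limit of F(.) w_n, where w_n are the Fourier partial sums of w, hence analytic.
   Conversely, analytic functions are bounded on compact sets, and the uniform
   boundedness principle gives the bound on the operator norms. *)

Require Import Defs.
From HB Require Import structures.
From mathcomp Require Import all_boot all_order all_algebra.
From mathcomp Require Import all_classical all_reals all_analysis.
From mathcomp Require Import complex ring lra.
Import Order.TTheory GRing.Theory Num.Theory.
Import numFieldNormedType.Exports.
Local Open Scope classical_set_scope.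
Local Open Scope ring_scope.

(** * Real-valued norms and completeness *)

Section RealNorm.
Context {R : realType}.
Local Notation C := R[i].

(** The norm has values in [R[i]]; its real part is the same number in the ordered field [R], where
    linear arithmetic applies. *)
Definition nrm {V : normedZmodType C} (x : V) : R := complex.Re `|x|.

Section NormTheory.
Context {V : normedZmodType C}.
Implicit Types x y : V.

Lemma normE x : `|x| = (nrm x)%:C%C.
Proof. by rewrite /nrm RRe_real// ger0_real. Qed.

Lemma norm_le x (M : R) : (`|x| <= M%:C%C) = (nrm x <= M).
Proof. by rewrite normE lecR. Qed.

Lemma nrm_ge0 x : 0 <= nrm x.
Proof. by rewrite -ler0c -normE. Qed.

Lemma nrm0 : nrm (0 : V) = 0.
Proof. by apply: complexI; rewrite -normE normr0. Qed.

Lemma nrm0_eq0 x : nrm x = 0 -> x = 0.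
Proof. by move=> x0; apply/normr0_eq0; rewrite normE x0. Qed.

Lemma nrm_gt0 x : (0 < nrm x) = (x != 0).
Proof. by rewrite -ltcR -normE normr_gt0. Qed.

Lemma nrmN x : nrm (- x) = nrm x.
Proof. by rewrite /nrm normrN. Qed.

Lemma nrmC x y : nrm (x - y) = nrm (y - x).
Proof. by rewrite -nrmN opprB. Qed.

Lemma nrmD x y : nrm (x + y) <= nrm x + nrm y.
Proof. by rewrite -norm_le rmorphD/= -!normE ler_normD. Qed.

Lemma nrmB x y : nrm (x - y) <= nrm x + nrm y.
Proof. by rewrite -[nrm y]nrmN nrmD. Qed.

Lemma nrm_tri x y z : nrm (x - z) <= nrm (x - y) + nrm (y - z).
Proof. by rewrite -[x in X in X <= _](subrK y) -addrA nrmD. Qed.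

Lemma nrm_bi x y : nrm x - nrm y <= nrm (x - y).
Proof. by have := nrmD (x - y) y; rewrite subrK lerBlDr. Qed.

Lemma nrm_le_eps (x : V) : (forall e : R, 0 < e -> nrm x <= e) -> x = 0.
Proof.
move=> h; apply: nrm0_eq0; apply/eqP; rewrite eq_le nrm_ge0 andbT.
by apply/ler_addgt0Pr => e e0; rewrite add0r h.
Qed.

End NormTheory.

Lemma nrmZ {V : normedModType C} (a : C) (x : V) : nrm (a *: x) = nrm a * nrm x.
Proof. by apply: complexI; rewrite rmorphM/= -!normE normrZ. Qed.

Lemma nrmM (a b : C) : nrm (a * b) = nrm a * nrm b.
Proof. by apply: complexI; rewrite rmorphM/= -!normE normrM. Qed.

Lemma nrmV (a : C) : nrm a^-1 = (nrm a)^-1.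
Proof. by apply: complexI; rewrite fmorphV/= -!normE normfV. Qed.

Lemma nrm1 : nrm (1 : C) = 1.
Proof. by apply: complexI; rewrite -normE normr1. Qed.

Lemma nrm_real (r : R) : nrm (r%:C%C : C) = `|r|.
Proof. by rewrite /nrm normc_def/= expr0n/= addr0 sqrtr_sqr. Qed.

Lemma nrm_i : nrm ('i%C : C) = 1.
Proof. by rewrite /nrm normc_def/= expr0n expr1n add0r sqrtr1. Qed.

Lemma nrm_nat (n : nat) : nrm (n%:R : C) = n%:R.
Proof. by rewrite -(rmorph_nat (@real_complex_def R (Phant R))) nrm_real normr_nat. Qed.

Lemma Re_le_nrm (a : C) : `|complex.Re a| <= nrm a.
Proof. by rewrite -lecR -normE normc_ge_Re. Qed.

Lemma Im_le_nrm (a : C) : `|complex.Im a| <= nrm a.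
Proof.
rewrite -[nrm a]mul1r -nrm_i mulrC -nrmM.
by rewrite (le_trans _ (Re_le_nrm _))// ReiNIm normrN.
Qed.

Lemma nrm_le_ReIm (a : C) : nrm a <= `|complex.Re a| + `|complex.Im a|.
Proof.
rewrite [a in X in X <= _]complexE; apply: (le_trans (nrmD _ _)).
by rewrite nrmM nrm_i mul1r !nrm_real.
Qed.

(** * Sequential completeness and nested balls *)

Definition cauchy_seq {V : normedZmodType C} (u : nat -> V) : Prop :=
  forall e : R, 0 < e -> exists N, forall m n, (N <= m)%N -> (N <= n)%N ->
    nrm (u m - u n) <= e.

Definition seq_lim {V : normedZmodType C} (u : nat -> V) (l : V) : Prop :=
  forall e : R, 0 < e -> exists N, forall n, (N <= n)%N -> nrm (u n - l) <= e.

(** Stated for any [normedZmodType], so that the nested-ball argument serves both the scalars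
    (Goursat, mean value) and the Hilbert space (uniform boundedness). *)
Definition seq_complete (V : normedZmodType C) : Prop :=
  forall u : nat -> V, cauchy_seq u -> exists l, seq_lim u l.

Lemma seq_complete_completeNormedMod (X : completeNormedModType C) : seq_complete X.
Proof.
move=> u cu.
have : cvg (u @ \oo).
  apply/cauchy_cvgP/cauchy_ballP => e e0.
  have {e0} [r r0 ->] : exists2 r : R, 0 < r & e = r%:C%C.
    exists (complex.Re e); first by move: e0; rewrite ltcE => /andP[].
    by rewrite RRe_real// gtr0_real.
  have [N uN] := cu (r / 2) ltac:(by rewrite divr_gt0).
  exists ([set u n | n in [set n | (N <= n)%N]], [set u n | n in [set n | (N <= n)%N]]).
    by split; exists N => // n /= Nn; exists n.
  move=> [x y] /= [[m Nm <-] [n Nn <-]].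
  rewrite -ball_normE /= normE ltcR; apply: (le_lt_trans (uN _ _ Nm Nn)).
  by lra.
move=> /cvg_ex[l /cvgrPdist_le ul]; exists l => e e0.
have /= := ul e%:C%C; rewrite ltcR => /(_ e0) [N _ uN].
by exists N => n /uN /=; rewrite norm_le nrmC.
Qed.

Lemma seq_complete_real (u : nat -> R) :
  (forall e, 0 < e -> exists N, forall m n, (N <= m)%N -> (N <= n)%N ->
    `|u m - u n| <= e) ->
  exists l, forall e, 0 < e -> exists N, forall n, (N <= n)%N -> `|u n - l| <= e.
Proof.
move=> cu.
have : cvg (u @ \oo).
  apply/cauchy_cvgP/cauchy_ballP => e e0.
  have [N uN] := cu (e / 2) ltac:(by rewrite divr_gt0).
  exists ([set u n | n in [set n | (N <= n)%N]], [set u n | n in [set n | (N <= n)%N]]).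
    by split; exists N => // n /= Nn; exists n.
  move=> [x y] /= [[m Nm <-] [n Nn <-]].
  rewrite -ball_normE /=; apply: (le_lt_trans (uN _ _ Nm Nn)).
  by lra.
move=> /cvg_ex[l /cvgrPdist_le ul]; exists l => e e0.
have /= [N _ uN] := ul e e0.
by exists N => n /uN /=; rewrite distrC.
Qed.

(** Real and imaginary parts are dominated by the modulus, so both are Cauchy; their limits are
    recombined. *)
Lemma seq_complete_complex : seq_complete C.
Proof.
move=> u cu.
have [a ua] : exists l, forall e, 0 < e -> exists N, forall n, (N <= n)%N ->
    `|complex.Re (u n) - l| <= e.
  apply: seq_complete_real => e /cu[N uN]; exists N => m n Nm Nn.
  by apply: le_trans (uN _ _ Nm Nn); rewrite -raddfB Re_le_nrm.
have [b ub] : exists l, forall e, 0 < e -> exists N, forall n, (N <= n)%N ->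
    `|complex.Im (u n) - l| <= e.
  apply: seq_complete_real => e /cu[N uN]; exists N => m n Nm Nn.
  by apply: le_trans (uN _ _ Nm Nn); rewrite -raddfB Im_le_nrm.
exists (a +i* b)%C => e e0.
have [N1 h1] := ua (e / 2) ltac:(by rewrite divr_gt0).
have [N2 h2] := ub (e / 2) ltac:(by rewrite divr_gt0).
exists (maxn N1 N2) => n; rewrite geq_max => /andP[/h1 {}h1 /h2 {}h2].
apply: (le_trans (nrm_le_ReIm _)); rewrite !raddfB/=.
by lra.
Qed.

Lemma pow2_small (s e : R) : 0 < e -> exists n : nat, s / 2 ^+ n <= e.
Proof.
move=> e0; have [n sn] : exists n : nat, s / e <= n%:R.
  exists (Num.truncn (s / e)).+1; apply: ltW.
  by rewrite -truncn_le_nat.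
exists n; rewrite ler_pdivrMr ?exprn_gt0// -ler_pdivrMl// mulrC.
by apply: (le_trans sn); rewrite -natrX ler_nat ltnW// ltn_expl.
Qed.

(* The balls need not be nested: it is enough that consecutive centres are
   within [k] radii of each other. *)
Lemma nested_balls {V : normedZmodType C} (k : R) (P : nat -> V -> R -> Prop) c0 s0 :
  seq_complete V -> 0 <= k ->
  (forall n c s, 0 < s -> P n c s -> exists c' s',
    [/\ 0 < s', s' <= s / 2, nrm (c' - c) <= k * s & P n.+1 c' s']) ->
  0 < s0 -> P 0%N c0 s0 ->
  exists2 p, nrm (p - c0) <= 2 * k * s0 & forall n, exists c s,
    [/\ 0 < s, s <= s0 / 2 ^+ n, nrm (p - c) <= 2 * k * s & P n c s].
Proof.
move=> Vc k0 step s00 P0.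
(* A state carries its index, centre and radius together with the proof of [P], so that the step can
   be iterated. *)
pose T := {x : nat * V * R | 0 < x.2 /\ P x.1.1 x.1.2 x.2}.
have next (x : T) : {y : T | [/\ (sval y).1.1 = (sval x).1.1.+1,
    (sval y).2 <= (sval x).2 / 2 &
    nrm ((sval y).1.2 - (sval x).1.2) <= k * (sval x).2]}.
  apply: cid; case: x => -[[n c] s]/= [sp Pn].
  have [c' [s' [s'0 s's cc' Pn']]] := step _ _ _ sp Pn.
  by exists (exist _ (n.+1, c', s') (conj s'0 Pn')).
pose t n := iter n (fun x => sval (next x)) (exist _ (0%N, c0, s0) (conj s00 P0) : T).
pose c n := (sval (t n)).1.2; pose s n := (sval (t n)).2.
have tS n : [/\ (sval (t n.+1)).1.1 = (sval (t n)).1.1.+1, s n.+1 <= s n / 2 &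
   nrm (c n.+1 - c n) <= k * s n] by rewrite /s /c /=; case: (next _).
have idx n : (sval (t n)).1.1 = n by elim: n => [//|n IH]; case: (tS n) => -> _ _; rewrite IH.
have sgt n : 0 < s n by rewrite /s; case: (t n) => ? [].
have Pn n : P n (c n) (s n).
  by rewrite -{1}(idx n) /s /c; case: (t n) => ? [].
have sle n : s n <= s0 / 2 ^+ n.
  elim: n => [|n IH]; first by rewrite expr0 divr1.
  by case: (tS n) => _ h _; rewrite exprSr invfM mulrA; lra.
(* Telescoping: [s n.+1 <= s n / 2] gives [k * s n <= 2 * k * (s n - s n.+1)]. *)
have cdist n j : nrm (c (n + j)%N - c n) <= 2 * k * (s n - s (n + j)%N).
  elim: j => [|j IH]; first by rewrite addn0 !subrr nrm0 mulr0.
  rewrite addnS; have [_ h1 h2] := tS (n + j)%N.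
  have := nrm_tri (c (n + j).+1) (c (n + j)%N) (c n).
  have : k * s (n + j).+1 <= k * (s (n + j)%N / 2) by rewrite ler_wpM2l.
  by lra.
have cdist' n m : (n <= m)%N -> nrm (c m - c n) <= 2 * k * s n.
  move=> /subnKC <-; apply: (le_trans (cdist _ _)).
  by rewrite ler_wpM2l ?mulr_ge0// gerBl ltW.
have [p cp] : exists p, seq_lim c p.
  apply: Vc => e e0; have [N hN] := pow2_small (2 * (2 * k) * s0) e e0.
  exists N => m n Nm Nn; apply: (le_trans (nrm_tri _ (c N) _)).
  rewrite (nrmC (c N)); apply: le_trans hN.
  have := cdist' _ _ Nm; have := cdist' _ _ Nn.
  have : 2 * k * s N <= 2 * k * (s0 / 2 ^+ N) by rewrite ler_wpM2l ?mulr_ge0.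
  by lra.
have pc n : nrm (p - c n) <= 2 * k * s n.
  apply/ler_addgt0Pr => e /cp[N hN].
  have := hN _ (leq_maxr n N); have := cdist' _ _ (leq_maxl n N).
  have := nrm_tri p (c (maxn n N)) (c n).
  by rewrite (nrmC p (c (maxn n N))); lra.
exists p => [|n]; first exact: (pc 0%N).
by exists (c n), (s n).
Qed.

End RealNorm.

(** * Midpoint sums over segments and squares *)

Lemma addr_transpose42 {V : zmodType} (a b c d a' b' c' d' : V) :
  (a + a') + (b + b') + (c + c') + (d + d') = (a + b + c + d) + (a' + b' + c' + d').
Proof. by rewrite (addrACA a) (addrACA (a + b)) (addrACA (a + b + c)). Qed.

(** Bookkeeping for cutting a square into quarters: [P], [Q], [S], [T] are the sums over the four
    inner half-sides, each met once in either direction. *)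
Lemma addr_cancel_interior {V : zmodType} (b1 b2 r1 r2 t1 t2 l1 l2 P Q S T : V) :
  (b1 + b2) + (r1 + r2) + (- t1 - t2) + (- l1 - l2) =
  (P + r2 - t1 - Q) + (b2 + r1 - P - T) + ((S + Q - t2 - l1) + (b1 + T - S - l2)).
Proof.
rewrite !addrA.
rewrite [RHS](ACl ((1*7)*(10*4)*(14*8)*(9*15)*(13*5*6*2*3*11*12*16))).
by rewrite /= !subrr !add0r.
Qed.

Section MidpointSums.
Context {R : realType}.
Local Notation C := R[i].
Local Notation I := ('i%C : C).

Section Sums.
Context {X : normedModType C}.
Implicit Types (f g : C -> X) (c v s : C) (x y : X) (n : nat).

(* Midpoint rule with 2^n cells for the integral of f over the segment
   [c - v, c + v]. *)
Fixpoint seg f n c v : X :=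
  if n is m.+1 then seg f m (c - v / 2) (v / 2) + seg f m (c + v / 2) (v / 2)
  else (2 * v) *: f c.

(* The same for the boundary of the square with centre c and half-side s. *)
Definition sq f n c s : X :=
  seg f n (c - I * s) s + seg f n (c + s) (I * s) +
  seg f n (c + I * s) (- s) + seg f n (c - s) (- (I * s)).

Lemma segN f n c v : seg f n c (- v) = - seg f n c v.
Proof.
elim: n c v => [|n IH] c v /=; first by rewrite mulrN scaleNr.
by rewrite mulNr opprK !IH addrC opprD.
Qed.

Lemma segD f g n c v :
  seg (fun z => f z + g z) n c v = seg f n c v + seg g n c v.
Proof.
elim: n c v => [|n IH] c v /=; first by rewrite scalerDr.
by rewrite !IH addrACA.
Qed.

(** The midpoint rule is exact on affine functions: the opposite shifts of the two half-centres
    cancel. *)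
Lemma seg_affine x y n c v :
  seg (fun z => x + z *: y) n c v = (2 * v) *: (x + c *: y).
Proof.
elim: n c v => [//|n IH] c v /=.
rewrite !IH !scalerDr !scalerA addrACA.
rewrite -[_ *: x + _]scalerDl -[_ *: y + _]scalerDl.
by congr (_ *: _ + _ *: _); field.
Qed.

(** Length times maximum. The two halves correspond to the parameters [(t - 1) / 2] and
    [(t + 1) / 2], so the hypothesis passes to them. *)
Lemma seg_bound f n c v (M : R) :
  (forall t : R, `|t| <= 1 -> nrm (f (c + t%:C%C * v)) <= M) ->
  nrm (seg f n c v) <= 2 * nrm v * M.
Proof.
elim: n c v => [|n IH] c v fM /=.
  rewrite nrmZ nrmM nrm_nat ler_wpM2l ?mulr_ge0 ?nrm_ge0//.
  by have := fM 0; rewrite normr0 ler01 rmorph0 mul0r addr0; apply.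
have nv2 : nrm (v / 2) = nrm v / 2 by rewrite nrmM nrmV nrm_nat.
apply: (le_trans (nrmD _ _)).
have h1 : nrm (seg f n (c - v / 2) (v / 2)) <= 2 * nrm (v / 2) * M.
  apply: IH => t; rewrite ler_norml => /andP[t1 t2].
  rewrite (_ : _ + _ = c + ((t - 1) / 2)%:C%C * v).
    by apply: fM; rewrite ler_norml; lra.
  by rewrite rmorphM fmorphV rmorphB rmorph1 rmorph_nat/=; field.
have h2 : nrm (seg f n (c + v / 2) (v / 2)) <= 2 * nrm (v / 2) * M.
  apply: IH => t; rewrite ler_norml => /andP[t1 t2].
  rewrite (_ : _ + _ = c + ((t + 1) / 2)%:C%C * v).
    by apply: fM; rewrite ler_norml; lra.
  by rewrite rmorphM fmorphV rmorphD rmorph1 rmorph_nat/=; field.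
by move: h1 h2; rewrite nv2; lra.
Qed.

(** Change of variable [z -> d z] for a homogeneous function; it provides the symmetries of [z^-1]
    and [z^-2] under rotation, scaling and reflection. *)
Lemma seg_homog (d : C) (e : C) f n c v : d != 0 ->
  (forall z, f (d * z) = e *: f z) ->
  seg f n (d * c) (d * v) = (d * e) *: seg f n c v.
Proof.
move=> d0 fd; elim: n c v => [|n IH] c v /=.
  by rewrite fd !scalerA; congr (_ *: _); ring.
by rewrite -!mulrA -mulrBr -mulrDr !IH -scalerDr.
Qed.

Lemma sqD f g n c s : sq (fun z => f z + g z) n c s = sq f n c s + sq g n c s.
Proof.
rewrite /sq !segD.
exact: addr_transpose42.
Qed.

Lemma sq_affine x y n c s : sq (fun z => x + z *: y) n c s = 0.
Proof.
rewrite /sq !seg_affine !scalerDr !scalerA.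
rewrite addr_transpose42.
rewrite -!(scalerDl x) -!(scalerDl y).
rewrite [X in X *: x](_ : _ = 0); last by ring.
rewrite [X in X *: y](_ : _ = 0); last by ring.
by rewrite !scale0r addr0.
Qed.

(** Perimeter times maximum. Only boundary points, where [a] or [b] has modulus 1, are tested, so
    the function may be singular at the centre. *)
Lemma sq_bound f n c (s : R) (M : R) : 0 <= s ->
  (forall a b : R, `|a| <= 1 -> `|b| <= 1 -> (`|a| = 1) \/ (`|b| = 1) ->
     nrm (f (c + a%:C%C * s%:C%C + b%:C%C * (I * s%:C%C))) <= M) ->
  nrm (sq f n c s%:C%C) <= 8 * s * M.
Proof.
move=> s0 fM.
have N1 : `|1 : R| <= 1 by rewrite normr1.
have ns : nrm (s%:C%C : C) = s by rewrite nrm_real ger0_norm.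
have nNs : nrm (- s%:C%C : C) = s by rewrite nrmN.
have nis : nrm (I * s%:C%C) = s by rewrite nrmM nrm_i mul1r.
have nNis : nrm (- (I * s%:C%C)) = s by rewrite nrmN.
have e1 : nrm (seg f n (c - I * s%:C%C) s%:C%C) <= 2 * s * M.
  rewrite -[X in 2 * X]ns; apply: seg_bound => t t1.
  rewrite (_ : _ + _ = c + t%:C%C * s%:C%C + (-1)%:C%C * (I * s%:C%C)).
    by apply: fM => //; [rewrite normrN | right; rewrite normrN normr1].
  by rewrite rmorphN rmorph1; ring.
have e2 : nrm (seg f n (c + s%:C%C) (I * s%:C%C)) <= 2 * s * M.
  rewrite -[X in 2 * X]nis; apply: seg_bound => t t1.
  rewrite (_ : _ + _ = c + 1%:C%C * s%:C%C + t%:C%C * (I * s%:C%C)).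
    by apply: fM => //; left; rewrite normr1.
  by rewrite rmorph1; ring.
have e3 : nrm (seg f n (c + I * s%:C%C) (- s%:C%C)) <= 2 * s * M.
  rewrite -[X in 2 * X]nNs; apply: seg_bound => t t1.
  rewrite (_ : _ + _ = c + (- t)%:C%C * s%:C%C + 1%:C%C * (I * s%:C%C)).
    by apply: fM => //; [rewrite normrN | right; rewrite normr1].
  by rewrite rmorphN rmorph1; ring.
have e4 : nrm (seg f n (c - s%:C%C) (- (I * s%:C%C))) <= 2 * s * M.
  rewrite -[X in 2 * X]nNis; apply: seg_bound => t t1.
  rewrite (_ : _ + _ = c + (-1)%:C%C * s%:C%C + (- t)%:C%C * (I * s%:C%C)).
    by apply: fM => //; rewrite ?normrN//; left; rewrite normr1.
  by rewrite !rmorphN rmorph1; ring.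
rewrite /sq; set A := seg _ _ _ _ in e1 *; set B := seg _ _ _ _ in e2 *.
set D := seg _ _ _ _ in e3 *; set E := seg _ _ _ _ in e4 *.
have := nrmD (A + B + D) E; have := nrmD (A + B) D; have := nrmD A B.
by lra.
Qed.

(** The first recursion level of [seg] halves each side; the inner half-sides are traversed in both
    directions and cancel. *)
Lemma sq_split f n c s : sq f n.+1 c s =
  sq f n (c + (1 + I) * (s / 2)) (s / 2) + sq f n (c + (1 - I) * (s / 2)) (s / 2) +
  (sq f n (c + (-1 + I) * (s / 2)) (s / 2) + sq f n (c + (-1 - I) * (s / 2)) (s / 2)).
Proof.
rewrite /sq /= !mulNr !opprK !segN.
have -> : I * s / 2 = I * (s / 2) by rewrite mulrA.
set h := s / 2; have -> : s = h + h by rewrite /h; field.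
have E a b a' : a = b -> seg f n a a' = seg f n b a' by move=> ->.
rewrite (E (c - I * (h + h) - h) (c + (-1 - I) * h - I * h)); last by ring.
rewrite (E (c - I * (h + h) + h) (c + (1 - I) * h - I * h)); last by ring.
rewrite (E (c + (h + h) - I * h) (c + (1 - I) * h + h)); last by ring.
rewrite (E (c + (h + h) + I * h) (c + (1 + I) * h + h)); last by ring.
rewrite (E (c + I * (h + h) + h) (c + (1 + I) * h + I * h)); last by ring.
rewrite (E (c + I * (h + h) - h) (c + (-1 + I) * h + I * h)); last by ring.
rewrite (E (c - (h + h) + I * h) (c + (-1 + I) * h - h)); last by ring.
rewrite (E (c - (h + h) - I * h) (c + (-1 - I) * h - h)); last by ring.
rewrite (E (c + (1 + I) * h - h) (c + I * h)); last by ring.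
rewrite (E (c + (1 + I) * h - I * h) (c + h)); last by ring.
rewrite (E (c + (1 - I) * h - h) (c - I * h)); last by ring.
rewrite (E (c + (1 - I) * h + I * h) (c + h)); last by ring.
rewrite (E (c + (-1 + I) * h + h) (c + I * h)); last by ring.
rewrite (E (c + (-1 + I) * h - I * h) (c - h)); last by ring.
rewrite (E (c + (-1 - I) * h + h) (c - I * h)); last by ring.
rewrite (E (c + (-1 - I) * h + I * h) (c - h)); last by ring.
exact: addr_cancel_interior.
Qed.

End Sums.
End MidpointSums.

(** * Complex derivatives *)

Section ComplexDerivative.
Context {R : realType}.
Local Notation C := R[i].
Local Notation I := ('i%C : C).

Lemma complex_gt0 (e : C) : 0 < e -> exists2 r : R, 0 < r & e = r%:C%C.
Proof.
move=> e0; exists (complex.Re e); first by move: e0; rewrite ltcE => /andP[].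
by rewrite RRe_real// gtr0_real.
Qed.

Section HasDeriv.
Context {X : normedModType C}.
Implicit Types (f g : C -> X) (p : C) (y : X).

(** Differentiability without division: [h = 0] is allowed and all bounds are non-strict. *)
Definition has_deriv f p y : Prop :=
  forall e : R, 0 < e -> exists2 d : R, 0 < d & forall h : C, nrm h <= d ->
    nrm (f (p + h) - f p - h *: y) <= e * nrm h.

Lemma has_derivP f p :
  derivable (f : Cplx R -> X) p (1 : Cplx R) <-> exists y, has_deriv f p y.
Proof.
split.
  move=> /cvg_ex[y /cvgrPdist_le fy]; exists y => e e0.
  have /= := fy e%:C%C; rewrite ltcR => /(_ e0).
  rewrite /= => /nbhs_ballP[d' /complex_gt0[d d0 ->]] hd.
  (* Halving passes from the open ball of the filter to a closed condition on [h]. *)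
  exists (d / 2); first by rewrite divr_gt0.
  move=> h hd2; have [->|h0] := eqVneq h 0.
    by rewrite addr0 subrr scale0r subr0 !nrm0 mulr0.
  have /= := hd h; rewrite -ball_normE /= sub0r normrN.
  rewrite normE ltcR => /(_ ltac:(lra) h0).
  rewrite norm_le nrmC => H.
  rewrite (_ : _ - _ - _ = h *: (h^-1 *: (f (h *: 1 + p) - f p) - y)).
    by rewrite nrmZ mulrC ler_wpM2r ?nrm_ge0.
  rewrite scalerBr scalerA divff// scale1r.
  by rewrite (_ : h *: 1 = h) ?[h + p]addrC// /GRing.scale/= mulr1.
move=> [y fy]; apply/cvg_ex; exists y; apply/cvgrPdist_le => e' /complex_gt0[e e0 ->].
apply/nbhs_ballP.
have [d d0 hd] := fy e e0.
exists d%:C%C => /=; first by rewrite ltcR.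
move=> h; rewrite -ball_normE /= sub0r normrN normE ltcR => hd1 h0.
rewrite norm_le nrmC.
have nh : 0 < nrm h by rewrite nrm_gt0.
rewrite -(ler_pM2l nh) -nrmZ mulrC.
rewrite scalerBr scalerA divff// scale1r.
rewrite (_ : h *: 1 = h) ?[h + p]addrC//; last by rewrite /GRing.scale/= mulr1.
by rewrite hd// ltW.
Qed.

Lemma has_derivD f g p y y' :
  has_deriv f p y -> has_deriv g p y' -> has_deriv (fun z => f z + g z) p (y + y').
Proof.
move=> fy gy e e0; have e2 : 0 < e / 2 by rewrite divr_gt0.
have [d1 d10 h1] := fy _ e2; have [d2 d20 h2] := gy _ e2.
exists (Num.min d1 d2); first by rewrite lt_min d10 d20.
move=> h; rewrite le_min => /andP[/h1 {}h1 /h2 {}h2].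
rewrite scalerDr !opprD (addrACA (f (p + h))) (addrACA (f (p + h) - f p)).
by apply: (le_trans (nrmD _ _)); lra.
Qed.

Lemma has_derivZ (a : C) f p y :
  has_deriv f p y -> has_deriv (fun z => a *: f z) p (a *: y).
Proof.
move=> fy e e0.
have a1 : 0 < nrm a + 1 by rewrite ltr_wpDl ?nrm_ge0.
have [d d0 hd] := fy (e / (nrm a + 1)) ltac:(by rewrite divr_gt0).
exists d => // h /hd {}hd.
rewrite scalerA mulrC -scalerA -!scalerBr nrmZ.
have : nrm a * nrm (f (p + h) - f p - h *: y) <= nrm a * (e / (nrm a + 1) * nrm h).
  by rewrite ler_wpM2l ?nrm_ge0.
move/le_trans; apply; rewrite mulrA ler_wpM2r ?nrm_ge0//.
by rewrite mulrCA -[X in _ <= X]mulr1 ler_pM2l// ler_pdivrMr// mul1r lerDl ler01.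
Qed.

Lemma has_derivN f p y : has_deriv f p y -> has_deriv (fun z => - f z) p (- y).
Proof.
move=> fy e /fy[d d0 hd]; exists d => // h /hd {}hd.
by rewrite scalerN -!opprD nrmN.
Qed.

Lemma has_derivB f g p y y' :
  has_deriv f p y -> has_deriv g p y' -> has_deriv (fun z => f z - g z) p (y - y').
Proof. by move=> fy /has_derivN; exact: has_derivD. Qed.

Lemma has_deriv_cst x p : has_deriv (fun=> x) p 0.
Proof.
move=> e e0; exists 1 => // h _.
by rewrite subrr scaler0 subr0 nrm0 mulr_ge0 ?nrm_ge0 ?ltW.
Qed.

Lemma has_deriv_linear y p : has_deriv (fun z => z *: y) p y.
Proof.
move=> e e0; exists 1 => // h _.
by rewrite -!scalerBl [p + h]addrC addrK subrr scale0r nrm0 mulr_ge0 ?nrm_ge0 ?ltW.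
Qed.

Lemma has_deriv_shift f (a p : C) y :
  has_deriv f (p + a) y -> has_deriv (fun z => f (z + a)) p y.
Proof.
move=> fy e /fy[d d0 hd]; exists d => // h /hd.
by rewrite [p + h + a]addrAC.
Qed.

(** The definition with [e = 1] gives a Lipschitz bound at one point, used in the product rule and
    for local boundedness. *)
Lemma has_deriv_lip f p y : has_deriv f p y ->
  exists2 d : R, 0 < d & forall h, nrm h <= d ->
    nrm (f (p + h) - f p) <= (1 + nrm y) * nrm h.
Proof.
move=> /(_ 1 ltr01)[d d0 hd]; exists d => // h /hd.
have := nrmD (f (p + h) - f p - h *: y) (h *: y).
by rewrite subrK nrmZ mulrDl [nrm y * _]mulrC; lra.
Qed.

End HasDeriv.

Lemma has_deriv_inv (p : C) : p != 0 ->
  has_deriv (fun z : C => z^-1 : C^o) p (- (p ^+ 2)^-1 : C^o).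
Proof.
move=> p0 e e0.
have np : 0 < nrm p by rewrite nrm_gt0.
(* The first bound gives [|p + h| >= |p| / 2]; the second then makes the exact remainder
   [h^2 / (p^2 (p + h))] at most [e |h|]. *)
exists (Num.min (nrm p / 2) (e * nrm p ^+ 3 / 2)).
  by rewrite lt_min !divr_gt0// mulr_gt0// exprn_gt0.
move=> h; rewrite le_min => /andP[h1 h2].
have nph : nrm p / 2 <= nrm (p + h).
  by have := nrm_bi p (- h); rewrite opprK nrmN; lra.
have ph0 : p + h != 0 by rewrite -nrm_gt0; lra.
rewrite (_ : _ - _ - _ = h ^+ 2 / (p ^+ 2 * (p + h))); last first.
  by rewrite /GRing.scale/=; field; rewrite ph0 p0.
rewrite [nrm _]nrmM nrmV nrmM !expr2 !nrmM ler_pdivrMr ?mulr_gt0//; last by lra.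
rewrite [X in _ <= X]mulrAC ler_wpM2r ?nrm_ge0//.
apply: (le_trans h2).
have : e * (nrm p * nrm p * (nrm p / 2)) <= e * (nrm p * nrm p * nrm (p + h)).
  apply: ler_wpM2l; first exact: ltW.
  by apply: ler_wpM2l => //; rewrite mulr_ge0 ?nrm_ge0.
by rewrite !exprS expr0; lra.
Qed.

Lemma has_deriv_scale {X : normedModType C} (a : C -> C) (f : C -> X) (p : C)
    (a' : C) (y : X) :
  has_deriv (a : C -> C^o) p (a' : C^o) -> has_deriv f p y ->
  has_deriv (fun z => a z *: f z) p (a' *: f p + a p *: y).
Proof.
move=> ha hf e e0.
have [dl dl0 hl] := has_deriv_lip _ _ _ ha.
have P1 (r : R) : 0 <= r -> 0 < 3 * (r + 1) by move=> r0; lra.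
have C1 := P1 _ (nrm_ge0 (f p)).
have C2 := P1 _ (addr_ge0 (nrm_ge0 (a p)) (ltW (P1 _ (nrm_ge0 a')))).
have C3 := P1 _ (mulr_ge0 (addr_ge0 ler01 (nrm_ge0 (a' : C^o))) (nrm_ge0 y)).
have [d1 d10 h1] := ha (e / (3 * (nrm (f p) + 1))) ltac:(by rewrite divr_gt0).
have [d2 d20 h2] := hf (e / (3 * (nrm (a p) + 3 * (nrm a' + 1) + 1))) ltac:(by rewrite divr_gt0).
pose d3 := e / (3 * ((1 + nrm (a' : C^o)) * nrm y + 1)).
(* The final 1 ensures [|h| <= 1], hence [|a (p + h)| <= |a p| + 1 + |a'|]. The added ones in the
   denominators exclude division by zero. *)
exists (Num.min (Num.min dl d1) (Num.min (Num.min d2 d3) 1)).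
  by rewrite !lt_min dl0 d10 d20 /d3 divr_gt0/=.
move=> h; rewrite !le_min => /andP[/andP[/hl {}hl /h1 {}h1] /andP[/andP[/h2 {}h2 h3] hh1]].
(* Remainder of [a], remainder of [f], and a second-order cross term; each is at most
   [e / 3 * |h|]. *)
rewrite (_ : _ - _ - _ = (a (p + h) - a p - h *: (a' : C^o)) *: f p +
   a (p + h) *: (f (p + h) - f p - h *: y) + (h * (a (p + h) - a p)) *: y); last first.
  rewrite mulrBr !scalerBl !scalerBr scalerDr !scalerA [h * a (p + h)]mulrC.
  rewrite opprD !addrA.
  rewrite [RHS](ACl ((1*5)*(6*7)*4*2*3*8)) /=.
  by rewrite subrr addNr !add0r.
have H (r : R) : 0 <= r -> r * (e / (3 * (r + 1))) <= e / 3.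
  move=> r0; have r1 : 0 < r + 1 by rewrite ltr_wpDl.
  rewrite (_ : _ * _ = e / 3 * (r / (r + 1))); last by field; rewrite gt_eqF.
  by rewrite ler_piMr ?divr_ge0 ?(ltW e0)// ler_pdivrMr// mul1r lerDl.
have nh := nrm_ge0 h.
have B1 : nrm (f p) * nrm (a (p + h) - a p - h *: (a' : C^o)) <= e / 3 * nrm h.
  apply: (le_trans (ler_wpM2l (nrm_ge0 _) h1)); rewrite mulrA ler_wpM2r//.
  exact: H (nrm_ge0 _).
have B2 : nrm (a (p + h)) * nrm (f (p + h) - f p - h *: y) <= e / 3 * nrm h.
  have ra : 0 <= nrm (a p) + 3 * (nrm (a' : C) + 1).
    by have := nrm_ge0 (a p); have := nrm_ge0 (a' : C); lra.
  apply: (@le_trans _ _ ((nrm (a p) + 3 * (nrm (a' : C) + 1)) * nrm (f (p + h) - f p - h *: y))).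
    apply: ler_wpM2r; first exact: nrm_ge0.
    have E1 : nrm (a (p + h)) - nrm (a p) <= nrm (a (p + h) - a p) := nrm_bi _ _.
    have E2 : nrm (a (p + h) - a p) <= (1 + nrm (a' : C)) * nrm h := hl.
    have E3 : (1 + nrm (a' : C)) * nrm h <= (1 + nrm (a' : C)) * 1.
      by apply: ler_wpM2l => //; rewrite addr_ge0 ?nrm_ge0.
    by have := nrm_ge0 (a' : C); lra.
  apply: (le_trans (ler_wpM2l ra h2)); rewrite mulrA ler_wpM2r//.
  exact: H.
have B3 : nrm h * nrm (a (p + h) - a p) * nrm y <= e / 3 * nrm h.
  have E1 : nrm (a (p + h) - a p) <= (1 + nrm (a' : C)) * nrm h := hl.
  have r0 : 0 <= (1 + nrm (a' : C)) * nrm y.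
    by rewrite mulr_ge0 ?nrm_ge0// addr_ge0 ?nrm_ge0.
  have E2 := le_trans (ler_wpM2l r0 h3) (H _ r0).
  have E3 : nrm h * nrm (a (p + h) - a p) * nrm y <=
      nrm h * ((1 + nrm (a' : C)) * nrm y * nrm h).
    rewrite -[X in X <= _]mulrA; apply: ler_wpM2l => //.
    by rewrite mulrAC; apply: ler_wpM2r; first exact: nrm_ge0.
  by apply: (le_trans E3); rewrite mulrC ler_wpM2r.
set T1 := _ *: f p; set T2 := a (p + h) *: _; set T3 := _ *: y.
have N1 : nrm T1 <= e / 3 * nrm h by rewrite nrmZ mulrC.
have N2 : nrm T2 <= e / 3 * nrm h by rewrite nrmZ.
have N3 : nrm T3 <= e / 3 * nrm h by rewrite nrmZ nrmM.
by have := nrmD (T1 + T2) T3; have := nrmD T1 T2; lra.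
Qed.

End ComplexDerivative.

(** * Goursat's lemma *)

Section Cauchy.
Context {R : realType}.
Local Notation C := R[i].
Local Notation I := ('i%C : C).

Section Goursat.
Context {X : normedModType C}.
Implicit Types (f : C -> X) (u v : nat -> X).

Definition vanishing u : Prop :=
  forall e : R, 0 < e -> exists N, forall n, (N <= n)%N -> nrm (u n) <= e.

Lemma vanishingD u v :
  vanishing u -> vanishing v -> vanishing (fun n => u n + v n).
Proof.
move=> hu hv e e0; have e2 : 0 < e / 2 by rewrite divr_gt0.
have [N1 h1] := hu _ e2; have [N2 h2] := hv _ e2.
exists (maxn N1 N2) => n; rewrite geq_max => /andP[/h1 {}h1 /h2 {}h2].
by apply: (le_trans (nrmD _ _)); lra.
Qed.

Lemma half_complex (s : R) : (s / 2)%:C%C = s%:C%C / 2 :> C.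
Proof. by rewrite rmorphM fmorphV rmorph_nat. Qed.

Lemma nrm_square_diag (a b : R) (s : R) : `|a| <= 1 -> `|b| <= 1 -> 0 <= s ->
  nrm (a%:C%C * s%:C%C + b%:C%C * (I * s%:C%C)) <= 2 * s.
Proof.
move=> a1 b1 s0; apply: (le_trans (nrmD _ _)).
rewrite !nrmM nrm_i !nrm_real mul1r (ger0_norm s0).
have : `|a| * s <= 1 * s by rewrite ler_wpM2r.
have : `|b| * s <= 1 * s by rewrite ler_wpM2r.
by lra.
Qed.

(* A square violating the bound has a quarter violating it; at the common
   point of the nested quarters the bound follows from differentiability, as
   the midpoint sums of affine functions vanish. *)
Lemma goursat f (c0 : C) (s0 : R) : 0 < s0 ->
  (forall p, nrm (p - c0) <= 2 * s0 -> exists y, has_deriv f p y) ->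
  vanishing (fun n => sq f n c0 s0%:C%C).
Proof.
move=> s00 df e e0; apply: contrapT => bad.
(* The bound [eta * s ^+ 2] scales like the area, so the bounds on the four quarters add up to the
   bound on the square. *)
pose eta := e / s0 ^+ 2.
have eta0 : 0 < eta by rewrite divr_gt0// exprn_gt0.
pose P (_ : nat) (c : C) (s : R) := ~ exists N, forall n, (N <= n)%N ->
  nrm (sq f n c s%:C%C) <= eta * s ^+ 2.
(* [k = 1]: the centres of the quarters are [c + d * (s / 2)] with [|d| <= 2]. *)
have [|||p pc0 hp] := @nested_balls R C 1 P c0 s0 seq_complete_complex ler01.
- move=> n c s sp Pc; apply: contrapT => nochild.
  have good d : nrm d <= 2 -> exists N, forall n, (N <= n)%N ->
      nrm (sq f n (c + d * (s%:C%C / 2)) (s%:C%C / 2)) <= eta * s ^+ 2 / 4.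
    move=> d2; apply: contrapT => nd; apply: nochild.
    exists (c + d * (s%:C%C / 2)), (s / 2); split; rewrite ?divr_gt0//.
      rewrite addrAC subrr add0r nrmM -half_complex nrm_real gtr0_norm ?divr_gt0//.
      have : nrm d * (s / 2) <= 2 * (s / 2) by rewrite ler_wpM2r ?divr_ge0 ?(ltW sp).
      by lra.
    move=> [N hN]; apply: nd; exists N => m /hN; rewrite half_complex.
    by rewrite expr_div_n; lra.
  have n1 : nrm (1 : C) = 1 by rewrite nrm1.
  have ni : nrm I = 1 := nrm_i.
  have n2 (a b : C) : nrm a = 1 -> nrm b = 1 -> nrm (a + b) <= 2.
    by move=> a1 b1; have := nrmD a b; lra.
  have [N1 h1] := good (1 + I) ltac:(by rewrite n2).
  have [N2 h2] := good (1 - I) ltac:(by rewrite n2 ?nrmN).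
  have [N3 h3] := good (-1 + I) ltac:(by rewrite n2 ?nrmN).
  have [N4 h4] := good (-1 - I) ltac:(by rewrite n2 ?nrmN).
  (* The successor accounts for the level consumed by [sq_split]. *)
  apply: Pc; exists (maxn (maxn N1 N2) (maxn N3 N4)).+1 => -[//|m].
  rewrite ltnS !geq_max => /andP[/andP[/h1 {}h1 /h2 {}h2] /andP[/h3 {}h3 /h4 {}h4]].
  rewrite sq_split.
  set A := sq _ _ _ _ in h1 *; set B := sq _ _ _ _ in h2 *.
  set D := sq _ _ _ _ in h3 *; set E := sq _ _ _ _ in h4 *.
  have := nrmD (A + B) (D + E); have := nrmD A B; have := nrmD D E.
  by lra.
- exact: s00.
- move=> [N hN]; apply: bad; exists N => n /hN; rewrite /eta divfK//.
  by rewrite expf_neq0// gt_eqF.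
have [y fy] : exists y, has_deriv f p y by apply: df; rewrite mulr1 in pc0.
(* The boundary points lie within [4 * s] of [p] ([2 * s] to the centre, [2 * s] on to [p]) and the
   perimeter is [8 * s], whence the factor 32; [s <= d / 4] brings these points within reach of
   [hd]. *)
have [d d0 hd] := fy (eta / 32) ltac:(by rewrite divr_gt0).
have [n hn] := pow2_small s0 (d / 4) ltac:(by rewrite divr_gt0).
have [c [s [sp sn pc Pc]]] := hp n; apply: Pc; exists 0%N => m _.
rewrite mulr1 in pc.
pose r z := f z - (f p - p *: y + z *: y).
have fE : f = (fun z => (f p - p *: y + z *: y) + r z).
  by apply/funext => z; rewrite /r addrC subrK.
rewrite [X in sq X]fE sqD sq_affine add0r.
have -> : eta * s ^+ 2 = 8 * s * (eta / 32 * (4 * s)) by rewrite expr2; lra.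
apply: sq_bound; first exact: ltW.
move=> a b a1 b1 _; have := nrm_square_diag a b s a1 b1 (ltW sp).
set z := _ + _ + _; set w := _ + _ => w2.
have zp : nrm (z - p) <= 4 * s.
  rewrite (_ : z - p = w - (p - c)); last by rewrite /z /w; ring.
  by have := nrmB w (p - c); lra.
have := hd (z - p) ltac:(by lra).
rewrite (_ : p + (z - p) = z); last by ring.
rewrite (_ : f z - f p - _ = r z); last first.
  by rewrite /r scalerBl !opprD !opprK !addrA [LHS](ACl (1*2*4*3)).
have : eta / 32 * nrm (z - p) <= eta / 32 * (4 * s).
  apply: ler_wpM2l zp; apply: divr_ge0; last exact: ler0n.
  exact: ltW.
by lra.
Qed.
End Goursat.
End Cauchy.

(** * The Cauchy estimate *)

Section CauchyEstimate.
Context {R : realType}.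
Local Notation C := R[i].
Local Notation I := ('i%C : C).

(** Since [Im (1 / (c - i)) = 1 / (c^2 + 1) >= 1 / 2] for [|c| <= 1], a cell of length [2 * v]
    contributes at least [v]. This lower bound takes the place of the exact integral of [1 / z]. *)
Lemma Im_seg_inv n (c v : R) : 0 <= v -> `|c| + v <= 1 ->
  v <= complex.Im (seg (X := C^o) (fun z : C => z^-1) n (c%:C%C - I) v%:C%C).
Proof.
elim: n c v => [|n IH] c v v0 cv /=.
  have c1 : 0 < c ^+ 2 + 1 by rewrite ltr_wpDl// sqr_ge0.
  rewrite [X in _ <= X](_ : _ = 2 * v / (c ^+ 2 + 1)); last first.
    by field; rewrite gt_eqF//; lra.
  rewrite ler_pdivlMr//.
  have : c ^+ 2 <= 1.
    by rewrite -real_normK ?num_real// expr_le1//; lra.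
  move=> c2; have : v * (c ^+ 2 + 1) <= v * (1 + 1) by rewrite ler_wpM2l// lerD2r.
  by lra.
have E1 : c%:C%C - I - v%:C%C / 2 = (c - v / 2)%:C%C - I.
  by rewrite rmorphB/= half_complex addrAC.
have E2 : c%:C%C - I + v%:C%C / 2 = (c + v / 2)%:C%C - I.
  by rewrite rmorphD/= half_complex addrAC.
rewrite E1 E2 -half_complex raddfD/=.
have := ler_normB c (v / 2); have := ler_normD c (v / 2).
rewrite (@ger0_norm _ (v / 2)) ?divr_ge0// => a1 a2.
have v2 : 0 <= v / 2 by rewrite divr_ge0.
have := IH (c - v / 2) (v / 2) v2 ltac:(by lra).
have := IH (c + v / 2) (v / 2) v2 ltac:(by lra).
by lra.
Qed.

Section Estimate.
Context {X : normedModType C}.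
Implicit Types (f : C -> X) (y : X).

Lemma seg_scaler (a : C -> C) y n c v :
  seg (fun z => a z *: y) n c v = (seg (X := C^o) a n c v : C) *: y.
Proof.
elim: n c v => [|n IH] c v /=; first by rewrite scalerA.
by rewrite !IH scalerDl.
Qed.

Lemma I_neq0 : I != 0.
Proof. by rewrite -nrm_gt0 nrm_i. Qed.

(** The form [dz / z] is invariant under rotation by [i] and under scaling: the four sides
    contribute equally, independently of [s]. *)
Lemma sq_inv y n (s : C) : s != 0 -> sq (fun z => z^-1 *: y) n 0 s =
  (4 * (seg (X := C^o) (fun z : C => z^-1) n (- I) 1 : C)) *: y.
Proof.
move=> s0; pose g z : X := z^-1 *: y.
have gd (d : C) : forall z, g (d * z) = d^-1 *: g z.
  by move=> z; rewrite /g invfM scalerA.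
have gi c v : seg g n (I * c) (I * v) = seg g n c v.
  by rewrite (seg_homog I I^-1)// ?I_neq0// mulfV ?I_neq0// scale1r.
have II (z : C) : I * (I * z) = - z by rewrite mulrA -expr2 sqr_i mulN1r.
have IIN (z : C) : I * - (I * z) = z by rewrite mulrN II opprK.
rewrite /sq -/g sub0r add0r add0r sub0r.
have e1 : seg g n s (I * s) = seg g n (- (I * s)) s.
  by have := gi (- (I * s)) s; rewrite IIN.
have e2 : seg g n (I * s) (- s) = seg g n (- (I * s)) s.
  by have := gi s (I * s); rewrite II e1.
have e3 : seg g n (- s) (- (I * s)) = seg g n (- (I * s)) s.
  by have := gi (I * s) (- s); rewrite II mulrN e2.
rewrite e1 e2 e3.
rewrite (_ : seg g n (- (I * s)) s = seg g n (- I) 1); last first.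
  rewrite (_ : - (I * s) = s * - I); last by rewrite mulrN mulrC.
  rewrite -{2}[s]mulr1 (seg_homog s s^-1)// ?mulfV// scale1r//.
by rewrite seg_scaler -!scalerDl; congr (_ *: _); ring.
Qed.

(** As [z^-2] is even, opposite sides cancel. *)
Lemma sq_inv2 y n (s : C) : sq (fun z => (z^-1 * z^-1) *: y) n 0 s = 0.
Proof.
pose g z : X := (z^-1 * z^-1) *: y.
have gN c v : seg g n (- c) (- v) = - seg g n c v.
  rewrite -mulN1r -(mulN1r v) (seg_homog (-1) 1).
  - by rewrite mulr1 scaleN1r.
  - by rewrite oppr_eq0 oner_eq0.
  - by move=> z; rewrite /g mulN1r invrN mulrNN scale1r.
have e1 : seg g n (I * s) (- s) = - seg g n (- (I * s)) s.
  by have := gN (- (I * s)) s; rewrite opprK.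
rewrite /sq -/g sub0r add0r add0r sub0r e1 gN.
by rewrite addrAC addrK subrr.
Qed.

(** Lists the quarters starting from the corner [(e1, e2)] and ending with the opposite one, so that
    the four corners of a square can be treated alike. *)
Lemma sq_split_sign f n (c s e1 e2 : C) : e1 = 1 \/ e1 = -1 -> e2 = 1 \/ e2 = -1 ->
  sq f n.+1 c s =
  sq f n (c + (e1 + e2 * I) * (s / 2)) (s / 2) +
  sq f n (c + (e1 - e2 * I) * (s / 2)) (s / 2) +
  sq f n (c + (- e1 + e2 * I) * (s / 2)) (s / 2) +
  sq f n (c + (- e1 - e2 * I) * (s / 2)) (s / 2).
Proof.
rewrite sq_split addrA => -[->|->] [->|->]; rewrite ?mul1r ?mulN1r ?opprK.
- by [].
- by rewrite [LHS](ACl (2*1*4*3)).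
- by rewrite [LHS](ACl (3*4*1*2)).
- by rewrite [LHS](ACl (4*3*2*1)).
Qed.

Lemma vanishing_ext (u v : nat -> X) : (forall n, u n = v n) -> vanishing u -> vanishing v.
Proof. by move=> uv hu e /hu[N hN]; exists N => n /hN; rewrite uv. Qed.

Lemma vanishingS (u : nat -> X) : vanishing u -> vanishing (fun n => u n.+1).
Proof. by move=> hu e /hu[N hN]; exists N => n Nn; apply: hN; apply: leqW. Qed.

(** * Sums of the Cauchy kernel over concentric squares *)

Section Annulus.
Variables (f : C -> X) (s0 : R).
Hypothesis s00 : 0 < s0.
Hypothesis df : forall p, nrm p <= 2 * s0 -> exists y, has_deriv f p y.

(** The kernel [f(z) / z^2] for the derivative at 0, with value 0 at the origin because
    [0^-1 = 0]. *)
Let g (z : C) : X := (z^-1 * z^-1) *: f z.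

Lemma has_deriv_kernel p : p != 0 -> nrm p <= 2 * s0 -> exists y, has_deriv g p y.
Proof.
move=> p0 /df[y fy]; have iv := has_deriv_inv p p0.
have h1 := has_deriv_scale _ _ _ _ _ iv fy.
have h2 := has_deriv_scale _ _ _ _ _ iv h1.
eexists; rewrite (_ : g = fun z => z^-1 *: (z^-1 *: f z)); first exact: h2.
by apply/funext => z; rewrite scalerA.
Qed.

(** The disc of radius [s / 2] required by [goursat] misses the origin, as [|c| >= 3 / 4 * s], and
    stays within [2 * s0], as [|c| <= 3 / 2 * s]. *)
Lemma kernel_square_vanishing (a b s : R) (c : C) : 0 < s <= s0 ->
  c = (a * s)%:C%C + I * (b * s)%:C%C ->
  `|a| <= 3 / 4 -> `|b| <= 3 / 4 -> `|a| = 3 / 4 \/ `|b| = 3 / 4 ->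
  vanishing (fun n => sq g n c (s / 4)%:C%C).
Proof.
move=> /andP[sp ss0] cE a3 b3 ab.
have Rc : complex.Re c = a * s by rewrite cE /=; ring.
have Ic : complex.Im c = b * s by rewrite cE /=; ring.
have c_lo : 3 / 4 * s <= nrm c.
  have := Re_le_nrm c; have := Im_le_nrm c.
  rewrite Rc Ic !normrM (gtr0_norm sp).
  by case: ab => ->; lra.
have c_up : nrm c <= 3 / 2 * s.
  have := nrm_le_ReIm c; rewrite Rc Ic !normrM (gtr0_norm sp).
  have : `|a| * s <= 3 / 4 * s by rewrite ler_wpM2r// ltW.
  have : `|b| * s <= 3 / 4 * s by rewrite ler_wpM2r// ltW.
  by lra.
apply: goursat; first by rewrite divr_gt0.
move=> p pc; apply: has_deriv_kernel.
  rewrite -nrm_gt0; have := nrm_bi c (c - p); rewrite nrmC in pc.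
  by rewrite (_ : c - (c - p) = p); [lra | ring].
by have := nrm_bi p c; lra.
Qed.

(** Of the four parts of a quarter, the one touching the origin is subtracted; the other three have
    centres with coordinates (3/4, 3/4), (3/4, 1/4), (1/4, 3/4) times [s] up to sign. *)
Lemma kernel_corner_vanishing (e1 e2 s : R) : 0 < s <= s0 ->
  e1 = 1 \/ e1 = -1 -> e2 = 1 \/ e2 = -1 ->
  let d := e1%:C%C + e2%:C%C * I : C in
  vanishing (fun n => sq g n.+1 (d * (s%:C%C / 2)) (s%:C%C / 2) -
                      sq g n (d * (s%:C%C / 2 / 2)) (s%:C%C / 2 / 2)).
Proof.
move=> ss0 he1 he2 d.
have he1' : (e1%:C%C : C) = 1 \/ (e1%:C%C : C) = -1.
  by case: he1 => ->; [left|right]; rewrite ?rmorphN rmorph1.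
have he2' : (e2%:C%C : C) = 1 \/ (e2%:C%C : C) = -1.
  by case: he2 => ->; [left|right]; rewrite ?rmorphN rmorph1.
have s4 : s%:C%C / 2 / 2 = (s / 4)%:C%C :> C.
  by rewrite -!half_complex; congr (_%:C%C); lra.
have N1 : `|e1| = 1 by case: he1 => ->; rewrite ?normrN normr1.
have N2 : `|e2| = 1 by case: he2 => ->; rewrite ?normrN normr1.
have K (a b : R) :
    `|a| <= 3 / 4 -> `|b| <= 3 / 4 -> `|a| = 3 / 4 \/ `|b| = 3 / 4 ->
    vanishing (fun n => sq g n ((a * s)%:C%C + I * (b * s)%:C%C) (s / 4)%:C%C).
  by move=> *; apply: (kernel_square_vanishing a b s) => //.
have n34 : `|3 / 4 : R| = 3 / 4 by rewrite ger0_norm// divr_ge0.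
have n14 : `|1 / 4 : R| = 1 / 4 by rewrite ger0_norm// divr_ge0.
have V1 := K (e1 * (3 / 4)) (e2 * (3 / 4)).
have V2 := K (e1 * (3 / 4)) (e2 * (1 / 4)).
have V3 := K (e1 * (1 / 4)) (e2 * (3 / 4)).
rewrite (normrM e1) (normrM e2) N1 N2 n34 !mul1r in V1.
rewrite (normrM e1) (normrM e2) N1 N2 n34 n14 !mul1r in V2.
rewrite (normrM e1) (normrM e2) N1 N2 n34 n14 !mul1r in V3.
have {}V1 := V1 ltac:(lra) ltac:(lra) ltac:(by left).
have {}V2 := V2 ltac:(lra) ltac:(lra) ltac:(by left).
have {}V3 := V3 ltac:(lra) ltac:(lra) ltac:(by right).
have := vanishingD _ _ (vanishingD _ _ V1 V2) V3; apply: vanishing_ext => n.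
rewrite (sq_split_sign _ _ _ _ _ _ he1' he2') s4.
have -> : d * (s%:C%C / 2) + (- e1%:C%C - e2%:C%C * I) * (s / 4)%:C%C = d * (s / 4)%:C%C.
  by rewrite -s4 /d; field.
rewrite addrK; congr (sq _ _ _ _ + sq _ _ _ _ + sq _ _ _ _);
  by rewrite -s4 /d !rmorphM/= ?fmorphV ?rmorph_nat; field.
Qed.

(** The four parts touching the origin form the square of half-side [s / 2]. The levels [n.+2] and
    [n.+1] give both squares the same cell length. *)
Lemma kernel_annulus_vanishing (s : R) : 0 < s <= s0 ->
  vanishing (fun n => sq g n.+2 0 s%:C%C - sq g n.+1 0 (s / 2)%:C%C).
Proof.
move=> ss0.
have := vanishingD _ _
  (vanishingD _ _ (kernel_corner_vanishing 1 1 s ss0 (or_introl erefl) (or_introl erefl))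
    (kernel_corner_vanishing 1 (-1) s ss0 (or_introl erefl) (or_intror erefl)))
  (vanishingD _ _ (kernel_corner_vanishing (-1) 1 s ss0 (or_intror erefl) (or_introl erefl))
    (kernel_corner_vanishing (-1) (-1) s ss0 (or_intror erefl) (or_intror erefl))).
apply: vanishing_ext => n.
rewrite (sq_split g n.+1 0) (sq_split g n 0) half_complex.
rewrite !rmorphN !rmorph1 mul1r mulN1r !add0r !opprD.
by rewrite [RHS]addrACA; congr (_ + _); rewrite [RHS]addrACA.
Qed.

(** Telescoping over [p] halvings, each of which costs one level of subdivision. *)
Lemma kernel_shrink_vanishing (p : nat) :
  vanishing (fun n => sq g (n + p).+1 0 s0%:C%C - sq g n.+1 0 (s0 / 2 ^+ p)%:C%C).
Proof.
elim: p => [|p IH].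
  move=> e e0; exists 0%N => n _.
  by rewrite addn0 expr0 divr1 subrr nrm0 ltW.
have sp : 0 < s0 / 2 ^+ p <= s0.
  rewrite divr_gt0 ?exprn_gt0//= ler_pdivrMr ?exprn_gt0// ler_peMr ?(ltW s00)//.
  by rewrite exprn_ege1// ler1n.
have := vanishingD _ _ (vanishingS _ IH) (kernel_annulus_vanishing _ sp).
apply: vanishing_ext => n.
by rewrite addSnnS exprSr invfM mulrA addrA subrK.
Qed.

(** Near 0, [f(z) = f(0) + z y + r(z)]: over a small square the first term sums to 0, the second to
    [4 K y] with [|K| >= 1], the third to at most [8 * e]. Comparison with the outer square costs
    one more [e]. *)
Lemma cauchy_estimate0 (B : R) y :
  (forall p, nrm p <= 2 * s0 -> nrm (f p) <= B) -> has_deriv f 0 y ->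
  nrm y <= 2 * B / s0.
Proof.
move=> fB fy.
suff H (e : R) : 0 < e -> 4 * nrm y <= 8 * s0 * (B / s0 ^+ 2) + 9 * e.
  apply/ler_addgt0Pr => e e0; have := H (4 * e / 9) ltac:(by lra).
  rewrite (_ : 8 * s0 * (B / s0 ^+ 2) = 4 * (2 * B / s0)); first lra.
  by field; rewrite gt_eqF.
move=> e0; have [d d0 hd] := fy e e0.
(* The inner half-side [s] satisfies [2 * s <= d], so [hd] applies on the whole inner square. *)
have [p hp] := pow2_small (2 * s0) d d0.
have [N hN] := kernel_shrink_vanishing p e e0.
set s := s0 / 2 ^+ p in hN.
have sp : 0 < s by rewrite divr_gt0// exprn_gt0.
have far (a b t : R) : 0 < t -> `|a| = 1 \/ `|b| = 1 ->
    t <= nrm (0 + a%:C%C * t%:C%C + b%:C%C * (I * t%:C%C)).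
  move=> tp ab; set z := _ + _ + _.
  have Rz : complex.Re z = a * t by rewrite /z /=; ring.
  have Iz : complex.Im z = b * t by rewrite /z /=; ring.
  have := Re_le_nrm z; have := Im_le_nrm z.
  by rewrite Rz Iz !normrM (gtr0_norm tp); case: ab => ->; rewrite mul1r.
have outer n : nrm (sq g n 0 s0%:C%C) <= 8 * s0 * (B / s0 ^+ 2).
  apply: sq_bound; first exact: ltW.
  move=> a b a1 b1 ab; have := far a b s0 s00 ab.
  have := nrm_square_diag a b s0 a1 b1 (ltW s00); rewrite add0r.
  set z := _ + _ => z1 z2.
  have fz := fB z z1; have B0 := le_trans (nrm_ge0 _) fz.
  have nz : 0 < nrm z by apply: lt_le_trans z2.
  rewrite /g nrmZ nrmM nrmV mulrC expr2 invfM ler_pM ?mulr_ge0 ?invr_ge0 ?nrm_ge0//.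
  by rewrite ler_pM ?invr_ge0 ?nrm_ge0// lef_pV2.
pose r z := f z - f 0 - z *: y.
have inner n : sq g n 0 s%:C%C =
    (4 * (seg (X := C^o) (fun z : C => z^-1) n (- I) 1 : C)) *: y +
    sq (fun z => (z^-1 * z^-1) *: r z) n 0 s%:C%C.
  have s_neq0 : s%:C%C != 0 :> C by rewrite -nrm_gt0 nrm_real normr_gt0 gt_eqF.
  rewrite -(sq_inv y n s%:C%C)// -[sq _ _ _ _ in RHS]add0r -{1}(sq_inv2 (f 0) n s%:C%C).
  rewrite -!sqD; congr sq; apply/funext => z; rewrite /g /r.
  (* True at [z = 0] as well, where both sides are 0. *)
  have -> : z^-1 *: y = (z^-1 * z^-1) *: (z *: y).
    rewrite scalerA; have [->|z0] := eqVneq z 0; first by rewrite mulr0 invr0.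
    by rewrite mulfVK.
  by rewrite -!scalerDr -[f z - f 0 - _]addrA -opprD [f 0 + _ + (_ - _)]addrC subrK.
have rest n : nrm (sq (fun z => (z^-1 * z^-1) *: r z) n 0 s%:C%C) <= 8 * e.
  rewrite (_ : 8 * e = 8 * s * (e / s)); last by field; rewrite gt_eqF.
  apply: sq_bound; first exact: ltW.
  move=> a b a1 b1 ab; have := far a b s sp ab.
  have := nrm_square_diag a b s a1 b1 (ltW sp); rewrite add0r.
  set z := _ + _ => z1 z2.
  have nz : 0 < nrm z by apply: lt_le_trans z2.
  have : nrm (r z) <= e * nrm z.
    by have := hd z; rewrite add0r; apply; rewrite (le_trans z1)// /s mulrA.
  rewrite nrmZ nrmM nrmV => rz.
  apply: (@le_trans _ _ ((nrm z)^-1 / nrm z * (e * nrm z))).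
    by rewrite ler_wpM2l// mulr_ge0 ?invr_ge0 ?nrm_ge0.
  have E (t : R) : 0 < t -> t^-1 / t * (e * t) = e / t.
    by move=> t0; field; rewrite gt_eqF.
  rewrite E//.
  by rewrite ler_wpM2l ?(ltW e0)// lef_pV2.
have main : 4 * nrm y <= nrm (sq g N.+1 0 s%:C%C) + 8 * e.
  set K := seg (X := C^o) (fun z : C => z^-1) N.+1 (- I) 1.
  have K1 : 1 <= nrm (K : C).
    have := @Im_seg_inv N.+1 0 1 ler01; rewrite normr0 add0r lexx => /(_ isT).
    rewrite rmorph0 rmorph1 sub0r -/K => h; apply: (le_trans h).
    exact: le_trans (ler_norm _) (Im_le_nrm _).
  have := nrm_bi ((4 * (K : C)) *: y) (- sq (fun z => (z^-1 * z^-1) *: r z) N.+1 0 s%:C%C).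
  rewrite opprK -inner nrmN nrmZ nrmM nrm_nat.
  have : nrm y <= nrm (K : C) * nrm y by rewrite ler_peMl ?nrm_ge0.
  by have := rest N.+1; lra.
have := hN N (leqnn N); have := outer (N + p).+1.
have := nrm_bi (sq g N.+1 0 s%:C%C) (sq g (N + p).+1 0 s0%:C%C); rewrite nrmC.
by lra.
Qed.
End Annulus.

End Estimate.
End CauchyEstimate.

(** * Uniform limits of differentiable functions *)

Section UniformLimit.
Context {R : realType}.
Local Notation C := R[i].
Context {X : normedModType C}.
Implicit Types (f : C -> X) (y : X).

Lemma cauchy_estimate f (w : C) (s B : R) y : 0 < s ->
  (forall p, nrm (p - w) <= 2 * s -> exists y, has_deriv f p y) ->
  (forall p, nrm (p - w) <= 2 * s -> nrm (f p) <= B) ->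
  has_deriv f w y -> nrm y <= 2 * B / s.
Proof.
move=> s0 df fB fy; apply: (cauchy_estimate0 (fun z => f (z + w)) s s0).
- move=> p ps; have [|y' fy'] := df (p + w); first by rewrite addrK.
  by exists y'; exact: has_deriv_shift.
- by move=> p ps; apply: fB; rewrite addrK.
- by apply: has_deriv_shift; rewrite add0r.
Qed.

(** Bisection: if the increment over a segment is too large, so is the increment over one half. The
    halves shrink to a point where the bound on the derivative is contradicted. *)
Lemma mean_value_inequality f (c v : C) (M : R) : 0 <= M ->
  (forall p, nrm (p - c) <= nrm v -> exists2 y, has_deriv f p y & nrm y <= M) ->
  nrm (f (c + v) - f (c - v)) <= 2 * M * nrm v.
Proof.
move=> M0 df; have [->|v0] := eqVneq v 0.
  by rewrite addr0 subr0 subrr !nrm0 mulr0.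
have nv : 0 < nrm v by rewrite nrm_gt0.
suff H eta : 0 < eta -> nrm (f (c + v) - f (c - v)) <= 2 * (M + eta) * nrm v.
  apply/ler_addgt0Pr => e e0.
  have := H (e / (2 * nrm v)) ltac:(by rewrite divr_gt0// mulr_gt0).
  rewrite (_ : 2 * (M + _) * _ = 2 * M * nrm v + e)//.
  by field; rewrite gt_eqF.
move=> eta0; rewrite leNgt; apply/negP => bad.
pose P (_ : nat) (c' : C) (s : R) :=
  2 * (M + eta) * (s * nrm v) < nrm (f (c' + s%:C%C * v) - f (c' - s%:C%C * v)).
(* The half-segments are centred at [c' + u] and [c' - u] with [|u| = |v| / 2 * s], so [p] lies
   within [|v|] of [c]. *)
have [||||p pc hp] := @nested_balls R C (nrm v / 2) P c 1 seq_complete_complex.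
- by rewrite divr_ge0// nrm_ge0.
- move=> n c' s sp Pc.
  pose u := (s / 2)%:C%C * v.
  have nu : nrm u = nrm v / 2 * s.
    by rewrite /u nrmM nrm_real gtr0_norm ?divr_gt0//; lra.
  have su : s%:C%C * v = u + u by rewrite /u half_complex; field.
  have [lt1|le1] := ltP (2 * (M + eta) * (s / 2 * nrm v)) (nrm (f (c' + u + u) - f (c' + u - u))).
    exists (c' + u), (s / 2); split => //; first by rewrite divr_gt0.
    by rewrite addrAC subrr add0r nu.
  have [lt2|le2] := ltP (2 * (M + eta) * (s / 2 * nrm v)) (nrm (f (c' - u + u) - f (c' - u - u))).
    exists (c' - u), (s / 2); split => //; first by rewrite divr_gt0.
    by rewrite addrAC subrr add0r nrmN nu.
  exfalso; move: Pc; rewrite /P su => Pc.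
  have := nrm_tri (f (c' + (u + u))) (f c') (f (c' - (u + u))).
  move: le1 le2; rewrite subrK addrK -!addrA -opprD.
  by lra.
- exact: ltr01.
- by rewrite /P mul1r rmorph1 mul1r.
have [|y fy yM] := df p; first by move: pc; rewrite mulr1; lra.
(* Both endpoints are within [2 * s * |v|] of [p], so each linearisation error is at most
   [eta * s * |v|]. *)
have [d d0 hd] := fy (eta / 2) ltac:(by rewrite divr_gt0).
have [n hn] := pow2_small (2 * nrm v) d d0.
have [c' [s [sp sn pc' Pc]]] := hp n.
have vs : nrm v * s <= nrm v * (1 / 2 ^+ n) by rewrite ler_wpM2l// ltW.
have ns : nrm (s%:C%C * v) = s * nrm v by rewrite nrmM nrm_real gtr0_norm.
have close z : nrm (z - c') <= s * nrm v ->
    nrm (f z - f p - (z - p) *: y) <= eta * (s * nrm v).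
  move=> zc; have zp : nrm (z - p) <= 2 * (s * nrm v).
    by have := nrm_tri z c' p; rewrite (nrmC c'); lra.
  have := hd (z - p) ltac:(by lra); rewrite [p + _]addrC subrK.
  have : eta / 2 * nrm (z - p) <= eta / 2 * (2 * (s * nrm v)).
    by rewrite ler_wpM2l// divr_ge0// ltW.
  by lra.
have h1 := close (c' + s%:C%C * v) ltac:(by rewrite addrAC subrr add0r ns).
have h2 := close (c' - s%:C%C * v) ltac:(by rewrite addrAC subrr add0r nrmN ns).
move: Pc; rewrite /P => /lt_geF/negP; apply.
have E (F1 F2 F0 : X) (w1 w2 : C) :
    F1 - F2 = (F1 - F0 - (w1 - p) *: y) - (F2 - F0 - (w2 - p) *: y) + (w1 - w2) *: y.
  rewrite !scalerBl !opprD !opprK !addrA.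
  rewrite [RHS](ACl ((2*6)*(3*9)*(4*8)*(7*10)*(1*5))) /=.
  by rewrite !addNr !subrr !add0r.
set z1 := c' + _ in h1 *; set z2 := c' - _ in h2 *.
rewrite (E (f z1) (f z2) (f p) z1 z2).
have : nrm ((z1 - z2) *: y) <= 2 * s * nrm v * M.
  rewrite nrmZ (_ : z1 - z2 = 2 * (s%:C%C * v)); last by rewrite /z1 /z2; ring.
  by rewrite nrmM nrm_nat ns mulrA ler_wpM2l// !mulr_ge0// ltW.
set A := _ - _ - _ in h1 *; set B := _ - _ - _ in h2 *; set D := _ *: _.
have := nrmD (A - B) D; have := nrmB A B.
by lra.
Qed.

(* The Cauchy estimate for the increments [f (z + k) - f z] makes [f'] Lipschitz. *)
Lemma taylor_bound f (a : C) (rho B : R) y h : 0 < rho ->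
  (forall p, nrm (p - a) <= 4 * rho -> exists y, has_deriv f p y) ->
  (forall p, nrm (p - a) <= 4 * rho -> nrm (f p) <= B) ->
  has_deriv f a y -> nrm h <= rho ->
  nrm (f (a + h) - f a - h *: y) <= 8 * B / rho ^+ 2 * nrm h ^+ 2.
Proof.
move=> r0 df fB fy hr.
have B0 : 0 <= B.
  by apply: le_trans (fB a _); rewrite ?nrm_ge0// subrr nrm0 mulr_ge0// ltW.
(* The disc of radius [2 * rho] about [p] stays within [4 * rho] of [a]. *)
have D1 p y' : nrm (p - a) <= 2 * rho -> has_deriv f p y' -> nrm y' <= 2 * B / rho.
  move=> pa; apply: cauchy_estimate => // q qp; [apply: df | apply: fB];
    by have := nrm_tri q p a; lra.
have D2 z k : nrm k <= rho -> nrm (z - a) <= rho ->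
    nrm (f (z + k) - f z) <= 2 * B / rho * nrm k.
  move=> kr zr; have k2 : nrm (k / 2) = nrm k / 2 by rewrite nrmM nrmV nrm_nat.
  have := @mean_value_inequality f (z + k / 2) (k / 2) (2 * B / rho).
  rewrite addrK k2 (_ : z + k / 2 + k / 2 = z + k); last by field.
  rewrite (_ : _ * (nrm k / 2) = 2 * B / rho * nrm k); last by lra.
  apply; first by rewrite divr_ge0 ?mulr_ge0// ltW.
  move=> p pz.
  have pa : nrm (p - a) <= 2 * rho.
    have := nrm_tri p (z + k / 2) a; rewrite [z + _ - a]addrAC.
    by have := nrmD (z - a) (k / 2); lra.
  have [|y' fy'] := df p; first by lra.
  by exists y' => //; exact: D1 fy'.
(* Cauchy estimate with half-side [rho / 2] for the increment by [k], which [D2] bounds by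
   [2 * B / rho * |k|]. *)
have D3 k y' : nrm k <= rho -> has_deriv f (a + k) y' ->
    nrm (y' - y) <= 8 * B / rho ^+ 2 * nrm k.
  move=> kr fy'.
  rewrite (_ : _ * nrm k = 2 * (2 * B / rho * nrm k) / (rho / 2)); last first.
    by field; rewrite gt_eqF.
  apply: (@cauchy_estimate (fun z => f (z + k) - f z) a).
  - by rewrite divr_gt0.
  - move=> p pa; have [|y1 f1] := df p; first by lra.
    have [|y2 f2] := df (p + k).
      by have := nrmD (p - a) k; rewrite addrAC; lra.
    by exists (y2 - y1); apply: has_derivB => //; exact: has_deriv_shift.
  - by move=> p pa; apply: D2 => //; lra.
  - by apply: has_derivB => //; exact: has_deriv_shift.
(* The derivative of [g] is [f' - y], of size at most [8 * B / rho ^+ 2 * |h|] near [a] by [D3]; the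
   mean value inequality on the segment from [a] to [a + h] yields the second factor [|h|]. *)
pose g z := f z - z *: y.
have h2 : nrm (h / 2) = nrm h / 2 by rewrite nrmM nrmV nrm_nat.
have := @mean_value_inequality g (a + h / 2) (h / 2) (8 * B / rho ^+ 2 * nrm h).
rewrite addrK h2 (_ : a + h / 2 + h / 2 = a + h); last by field.
rewrite (_ : _ * (nrm h / 2) = 8 * B / rho ^+ 2 * nrm h ^+ 2); last first.
  by rewrite [nrm h ^+ 2]expr2; lra.
rewrite (_ : g (a + h) - g a = f (a + h) - f a - h *: y); last first.
  rewrite /g scalerDl !opprD !opprK !addrA.
  by rewrite [LHS](ACl ((2*5)*1*4*3)) /= addNr add0r.
have L0 : 0 <= 8 * B / rho ^+ 2 by apply: divr_ge0; [exact: mulr_ge0 | exact: sqr_ge0].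
apply; first by rewrite mulr_ge0 ?nrm_ge0.
move=> p pz.
have pa : nrm (p - a) <= nrm h.
  have := nrm_tri p (a + h / 2) a; rewrite [a + _ - a]addrAC subrr add0r.
  by lra.
have [|y' fy'] := df p; first by lra.
exists (y' - y); first by apply: has_derivB => //; exact: has_deriv_linear.
have := D3 (p - a) y' ltac:(by lra); rewrite [a + _]addrC subrK => /(_ fy').
by move/le_trans; apply; rewrite ler_wpM2l.
Qed.

(** The Cauchy estimate for [f_ m - f_ n] makes the derivatives at [a] a Cauchy sequence; a Taylor
    bound independent of [n] then passes to the limit. *)
Lemma has_deriv_uniform_limit (f_ : nat -> C -> X) (e_ : nat -> R) f (a : C) (rho B : R) :
  seq_complete X -> 0 < rho ->
  (forall e : R, 0 < e -> exists N, forall n, (N <= n)%N -> e_ n <= e) ->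
  (forall n p, nrm (p - a) <= 4 * rho -> exists y, has_deriv (f_ n) p y) ->
  (forall n p, nrm (p - a) <= 4 * rho -> nrm (f_ n p - f p) <= e_ n) ->
  (forall p, nrm (p - a) <= 4 * rho -> nrm (f p) <= B) ->
  exists y, has_deriv f a y.
Proof.
move=> Xc r0 e_0 df fe fB.
have a0 : nrm (a - a) <= 4 * rho by rewrite subrr nrm0 mulr_ge0// ltW.
have [y_ fy] := choice (fun n => df n a a0).
have [y yl] : exists y, seq_lim y_ y.
  (* The difference [f_ m - f_ n] is at most [e * rho], and half-side [2 * rho] in the Cauchy
     estimate returns exactly [e]. *)
  apply: Xc => e e0; have [N hN] := e_0 (e * rho / 2) ltac:(by rewrite divr_gt0// mulr_gt0).
  exists N => m n /hN Nm /hN Nn.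
  have -> : e = 2 * (e * rho) / (2 * rho) by field; rewrite gt_eqF.
  apply: (@cauchy_estimate (fun z => f_ m z - f_ n z) a (2 * rho)).
  - by rewrite mulr_gt0.
  - move=> p pa; rewrite mulrA -natrM in pa.
    have [y1 h1] := df m p pa; have [y2 h2] := df n p pa.
    by exists (y1 - y2); exact: has_derivB.
  - move=> p pa; rewrite mulrA -natrM in pa.
    have := fe m p pa; have := fe n p pa; have := nrm_tri (f_ m p) (f p) (f_ n p).
    by rewrite (nrmC (f p)); lra.
  - exact: has_derivB.
exists y.
have B0 : 0 <= B by apply: le_trans (fB a a0); exact: nrm_ge0.
(* Once [e_ n <= 1], the function [f_ n] is bounded by [B + 1]. *)
pose K := 8 * (B + 1) / rho ^+ 2.
have K0 : 0 < K by rewrite divr_gt0 ?exprn_gt0// mulr_gt0// ltr_wpDl.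
have H h : nrm h <= rho -> nrm (f (a + h) - f a - h *: y) <= K * nrm h ^+ 2.
  move=> hr; apply/ler_addgt0Pr => e e0.
  have ah : nrm (a + h - a) <= 4 * rho by rewrite addrAC subrr add0r; lra.
  have h1 : 0 < 3 * (nrm h + 1) by have := nrm_ge0 h; lra.
  have [N1 hN1] := e_0 (Num.min 1 (e / 3)) ltac:(by rewrite lt_min ltr01 divr_gt0).
  have [N2 hN2] := yl (e / (3 * (nrm h + 1))) ltac:(by rewrite divr_gt0).
  have := hN1 _ (leq_maxl N1 N2); have {hN2} := hN2 _ (leq_maxr N1 N2).
  set n := maxn _ _; rewrite le_min => ny /andP[en1 en].
  have T : nrm (f_ n (a + h) - f_ n a - h *: y_ n) <= K * nrm h ^+ 2.
    apply: taylor_bound => //.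
    - by move=> p; exact: df.
    - move=> p pa; have := fe n p pa; have := fB p pa.
      by have := nrm_bi (f_ n p) (f p); lra.
  have u1 := fe n (a + h) ah; have u2 := fe n a a0.
  have u3 : nrm (h *: (y_ n - y)) <= e / 3.
    rewrite nrmZ.
    have : nrm h * nrm (y_ n - y) <= (nrm h + 1) * (e / (3 * (nrm h + 1))).
      by rewrite ler_pM ?nrm_ge0// lerDl.
    by rewrite (_ : _ * (e / _) = e / 3)//; field; have := nrm_ge0 h; lra.
  rewrite (_ : f (a + h) - f a - h *: y = (f_ n (a + h) - f_ n a - h *: y_ n)
    - (f_ n (a + h) - f (a + h)) + (f_ n a - f a) + h *: (y_ n - y)); last first.
    rewrite scalerBr !opprD !opprK !addrA.
    rewrite [RHS](ACl ((1*4)*(2*6)*(3*8)*(5*7*9))) /=.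
    by rewrite subrr !addNr !add0r.
  set A := _ - _ - _ in T *; set E := _ - _ in u1 *; set D := _ - _ in u2 *.
  set G := _ *: _ in u3 *.
  have := nrmD (A - E + D) G; have := nrmD (A - E) D; have := nrmB A E.
  by lra.
move=> e e0; exists (Num.min rho (e / K)); first by rewrite lt_min r0 divr_gt0.
move=> h; rewrite le_min => /andP[/H hr hK]; apply: (le_trans hr).
by rewrite expr2 mulrA ler_wpM2r ?nrm_ge0// mulrC -ler_pdivlMr.
Qed.

End UniformLimit.

(** * Uniform boundedness and Fourier sums *)

Section HilbertSpace.
Context {R : realType}.
Local Notation C := R[i].

(* Gliding hump: outside a bound, a ball contains a smaller ball on which one of
   the operators is large. *)
Lemma uniform_boundedness {V W : normedModType C} {J : Type} (A : set J)
    (T : J -> V -> W) :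
  seq_complete V ->
  (forall i, A i -> linear (T i)) ->
  (forall i, A i -> exists M : R, forall x, nrm (T i x) <= M * nrm x) ->
  (forall x, exists B : R, forall i, A i -> nrm (T i x) <= B) ->
  exists M : R, forall i, A i -> forall x, nrm (T i x) <= M * nrm x.
Proof.
move=> Vc linT bT ptw; apply: contrapT => unb.
have {}unb M : exists i x, A i /\ M * nrm x < nrm (T i x).
  apply: contrapT => h; apply: unb; exists M => i Ai x.
  by rewrite leNgt; apply/negP => lt; apply: h; exists i, x.
pose P (n : nat) (c : V) (s : R) := n = 0%N \/ exists2 i, A i &
  forall y, nrm (y - c) <= s -> n%:R <= nrm (T i y).
(* With [k = 1 / 2] the limit point belongs to every ball. *)
have [||||p _ hp] := @nested_balls R V (1 / 2) P 0 1 Vc.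
- by lra.
- move=> n c s sp _.
  (* The constant is chosen so that [x] rescaled to norm [s / 2] has an image of norm at least
     [n + 2]. *)
  have [i [x [Ai Tx]]] := unb (2 * (n%:R + 2) / s).
  have TB a b : T i (a - b) = T i a - T i b.
    by rewrite addrC -scaleN1r linT// scaleN1r addrC.
  have T0 : T i 0 = 0 by rewrite -(subrr 0) TB subrr.
  have TZ a v : T i (a *: v) = a *: T i v by rewrite -[a *: v]addr0 linT// T0 addr0.
  have x0 : 0 < nrm x.
    rewrite nrm_gt0; apply/eqP => x0; move: Tx.
    by rewrite x0 T0 !nrm0 mulr0 ltxx.
  pose x' := (s / 2 / nrm x)%:C%C *: x.
  have nx' : nrm x' = s / 2.
    rewrite nrmZ nrm_real ger0_norm ?divfK ?gt_eqF// divr_ge0 ?divr_ge0//; exact: ltW.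
  have Tx' : n%:R + 2 <= nrm (T i x').
    rewrite TZ nrmZ nrm_real ger0_norm; last by rewrite !divr_ge0// ltW.
    have : s / 2 / nrm x * (2 * (n%:R + 2) / s * nrm x) <= s / 2 / nrm x * nrm (T i x).
      by apply: ler_wpM2l; [rewrite !divr_ge0// ltW | exact: ltW].
    by rewrite (_ : s / 2 / nrm x * (_ / s * _) = n%:R + 2)//; field; rewrite !gt_eqF.
  (* As [2 * T x' = T (c + x') - T (c - x')], one of [c + x'] and [c - x'] has an image at least as
     large as that of [x']. *)
  have [c' cc' Tc'] : exists2 c', nrm (c' - c) <= s / 2 & n%:R + 2 <= nrm (T i c').
    have [h|h] := leP (n%:R + 2) (nrm (T i (c + x'))).
      by exists (c + x') => //; rewrite addrAC subrr add0r nx'.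
    exists (c - x'); first by rewrite addrAC subrr add0r nrmN nx'.
    have : 2 * nrm (T i x') <= nrm (T i (c + x')) + nrm (T i (c - x')).
      rewrite -[2 * _](_ : nrm ((2 : C) *: T i x') = _); last by rewrite nrmZ nrm_nat.
      rewrite -TZ (_ : 2 *: x' = (c + x') - (c - x')); first by rewrite TB nrmB.
      by rewrite scaler_nat mulr2n opprB addrCA [c + x']addrC addrK.
    by lra.
  have [M hM] := bT i Ai.
  have M1 : 0 < `|M| + 1 by rewrite ltr_wpDl.
  (* On this radius [T i] varies by at most 1, which leaves [n + 1] out of [n + 2]. *)
  exists c', (Num.min (s / 2) (1 / (`|M| + 1))); split.
  + by rewrite lt_min !divr_gt0.
  + by rewrite ge_min lexx.
  + by lra.
  + right; exists i => // y; rewrite le_min => /andP[_ yc].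
    have := nrm_bi (T i c') (T i y); rewrite nrmC -TB.
    have : nrm (T i (y - c')) <= (`|M| + 1) * (1 / (`|M| + 1)).
      apply: (le_trans (hM _)); apply: (@le_trans _ _ ((`|M| + 1) * nrm (y - c'))).
        by rewrite ler_wpM2r ?nrm_ge0//; have := ler_norm M; lra.
      by rewrite ler_wpM2l// ltW.
    rewrite mulrC divfK ?gt_eqF// -[n.+1]addn1 natrD.
    by lra.
- exact: ltr01.
- by left.
have [B hB] := ptw p.
pose n := (Num.truncn B).+1.
have [c [s [sp _ pc]]] := hp n.
case=> [//|[i Ai hi]].
have : B < n%:R by rewrite -truncn_le_nat.
have := hi p ltac:(by lra); have := hB i Ai; lra.
Qed.

(** * Fourier expansion in an orthonormal basis *)

Section OrthonormalBasis.
Context {X : normedModType C} (ip : X -> X -> C) (u : nat -> X).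
Hypothesis ipP : is_inner_product ip.
Implicit Types x y z : X.

Lemma ipDl x y z : ip (x + y) z = ip x z + ip y z.
Proof. by case: ipP => h _; rewrite -[x]scale1r h mul1r scale1r. Qed.

Lemma ip0l z : ip 0 z = 0.
Proof. by apply: (@addrI _ (ip 0 z)); rewrite -ipDl !addr0. Qed.

Lemma ipZl a x z : ip (a *: x) z = a * ip x z.
Proof. by case: ipP => h _; rewrite -[a *: x]addr0 h ip0l addr0. Qed.

Lemma ipBl x y z : ip (x - y) z = ip x z - ip y z.
Proof. by rewrite ipDl -scaleN1r ipZl mulN1r. Qed.

Lemma ip_sym0 x y : ip x y = 0 -> ip y x = 0.
Proof. by case: ipP => _ [h _] xy; rewrite h xy conjC0. Qed.

Lemma ip_nrm x : ip x x = (nrm x ^+ 2)%:C%C.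
Proof. by case: ipP => _ [_ h]; rewrite h normE rmorphXn. Qed.

Lemma pythagoras x y : ip x y = 0 -> nrm (x + y) ^+ 2 = nrm x ^+ 2 + nrm y ^+ 2.
Proof.
move=> xy; have yx := ip_sym0 _ _ xy.
apply: complexI; rewrite rmorphD/= -!ip_nrm ipDl.
have H a b : ip a b = 0 -> ip a (a + b) = ip a a.
  move=> ab; have ba := ip_sym0 _ _ ab; case: (ipP) => _ [h _].
  by rewrite h ipDl ba addr0 -h.
by rewrite (H _ _ xy) addrC [x + y]addrC (H _ _ yx) addrC.
Qed.

Hypothesis uP : is_orthonormal_basis ip u.

(** Pythagoras for the projection of [x] on [u j] and its residual. *)
Lemma ip_unit_le x j : nrm (ip x (u j)) <= nrm x.
Proof.
have [uu _] := uP; have ujj : ip (u j) (u j) = 1 by rewrite uu eqxx.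
have nu : nrm (u j) = 1.
  have : (nrm (u j) ^+ 2)%:C%C = 1%:C%C :> C by rewrite -ip_nrm ujj.
  by move=> /complexI/eqP; rewrite sqrp_eq1 ?nrm_ge0// => /eqP.
set a := ip x (u j).
have : ip (x - a *: u j) (a *: u j) = 0.
  by apply: ip_sym0; rewrite ipZl ip_sym0 ?mulr0// ipBl ipZl ujj mulr1 subrr.
move=> /pythagoras; rewrite subrK nrmZ nu mulr1 => E.
rewrite -(@ler_pXn2r _ 2)// ?nnegrE ?nrm_ge0// E lerDr sqr_ge0.
by [].
Qed.

Definition fourier_sum w n : X := \sum_(k < n) ip w (u k) *: u k.

Lemma fourier_sum0 w : fourier_sum w 0 = 0.
Proof. exact: big_ord0. Qed.

Lemma fourier_sumS w n : fourier_sum w n.+1 = fourier_sum w n + ip w (u n) *: u n.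
Proof. exact: big_ord_recr. Qed.

Lemma fourier_sum_orth w j n : (j < n)%N -> ip (w - fourier_sum w n) (u j) = 0.
Proof.
move=> jn; have [uu _] := uP.
have E m : ip (fourier_sum w m) (u j) = if (j < m)%N then ip w (u j) else 0.
  elim: m => [|m IH]; first by rewrite fourier_sum0 ip0l.
  rewrite fourier_sumS ipDl IH ipZl uu ltnS.
  have [->|mj] := eqVneq m j; first by rewrite ltnn leqnn mulr1 add0r.
  by rewrite mulr0 addr0 [in RHS]leq_eqVlt eq_sym (negbTE mj).
by rewrite ipBl E jn subrr.
Qed.

Lemma fourier_sum_orth_diff w m n : (m <= n)%N ->
  ip (w - fourier_sum w n) (fourier_sum w n - fourier_sum w m) = 0.
Proof.
move=> mn; apply: ip_sym0.
have H k : (k <= n)%N -> ip (fourier_sum w k) (w - fourier_sum w n) = 0.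
  elim: k => [_|k IH kn]; first by rewrite fourier_sum0 ip0l.
  rewrite fourier_sumS ipDl (IH (ltnW kn)).
  by rewrite ipZl add0r (ip_sym0 _ _ (fourier_sum_orth w k n kn)) mulr0.
by rewrite ipBl !H// subrr.
Qed.

(** By Pythagoras the squared residuals [q] decrease, and their drops are the squared distances
    between partial sums, so the sums are Cauchy. The limit has the same coefficients as [w], hence
    equals [w] by completeness of the basis. *)
Lemma fourier_sum_lim w : seq_complete X -> seq_lim (fourier_sum w) w.
Proof.
move=> Xc; pose S := fourier_sum w; pose q n := nrm (w - S n) ^+ 2.
have qE m n : (m <= n)%N -> q m = q n + nrm (S n - S m) ^+ 2.
  move=> mn; rewrite /q -pythagoras; last exact: fourier_sum_orth_diff.
  by rewrite addrA subrK.
have qinf : has_inf (range q).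
  split; first by exists (q 0%N), 0%N.
  by exists 0 => _ [n _ <-]; exact: sqr_ge0.
have cS : cauchy_seq S.
  have H e : 0 < e -> exists N, forall m n, (N <= m)%N -> (m <= n)%N ->
      nrm (S n - S m) <= e.
    (* From [N] on, [q] stays within [e ^+ 2] of its infimum. *)
    move=> e0; have [_ [N _ <-] qN] := @inf_adherent _ _ (e ^+ 2) ltac:(by rewrite exprn_gt0) qinf.
    exists N => m n Nm mn.
    have L : inf (range q) <= q n by apply: ge_inf; [case: qinf | exists n].
    have := qE _ _ Nm; have := qE _ _ mn; have := sqr_ge0 (nrm (S m - S N)) => s0 e1 e2.
    rewrite -(@ler_pXn2r _ 2)// ?nnegrE ?nrm_ge0// ?(ltW e0)//.
    by lra.
  move=> e /H[N hN]; exists N => m n Nm Nn.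
  have [mn|/ltnW nm] := leqP m n; last exact: hN.
  by rewrite nrmC; exact: hN.
have [v Sv] := Xc _ cS.
suff wv : w = v by rewrite {2}wv.
apply/eqP; rewrite -subr_eq0; apply/eqP.
have [_] := uP; apply=> j; apply: nrm_le_eps => e /Sv[N hN].
(* Orthogonality of [w - S n] to [u j] requires [j < n]. *)
set n := maxn N j.+1; have := hN n (leq_maxl _ _).
rewrite (_ : w - v = (w - S n) + (S n - v)); last by rewrite addrA subrK.
rewrite ipDl fourier_sum_orth ?leq_maxr// add0r.
by apply: le_trans; exact: ip_unit_le.
Qed.

End OrthonormalBasis.
End HilbertSpace.

(** * Functions with operator values *)

Section OperatorFunctions.
Context {R : realType}.
Local Notation C := R[i].
Local Notation I := ('i%C : C).

Lemma opnorm_leE {X : normedModType C} (T : X -> X) (M : R) :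
  opnorm_le T M <-> forall x, nrm (T x) <= M * nrm x.
Proof.
by split => h x; have := h x; rewrite [`|x|]normE -rmorphM norm_le.
Qed.

Lemma nbhs_nrm (x : Cplx R) (d : R) : 0 < d ->
  \forall x' \near x, nrm (x' - x : C) <= d.
Proof.
move=> d0; apply/nbhs_ballP; exists d%:C%C => /=; first by rewrite ltcR.
by move=> z; rewrite -ball_normE /= [`|_|]normE ltcR nrmC => /ltW.
Qed.

(** Pointwise Lipschitz bounds are local bounds; with [B] near [+oo] as parameter, near-covering
    compactness merges them into one. *)
Lemma compact_bounded_deriv {X : normedModType C} (K : set (Cplx R)) (f : C -> X) :
  compact K -> (forall p, K p -> exists y, has_deriv f p y) ->
  exists B : R, forall p, K p -> nrm (f p) <= B.
Proof.
move=> /compact_near_coveringP cK df.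
have : \forall B \near +oo, K `<=` (fun p => nrm (f p) <= B).
  apply: (cK R (pinfty_nbhs R) (fun B p => nrm (f p) <= B)) => x /df[y /has_deriv_lip[d d0 fd]].
  exists ([set x' | nrm (x' - x : C) <= d],
    [set B | nrm (f x) + (1 + nrm y) * d <= B]).
    by split => /=; [exact: nbhs_nrm | by apply: nbhs_pinfty_ge; exact: num_real].
  move=> [x' B] /= [x'd hB].
  have := fd (x' - x) x'd; rewrite [x + _]addrC subrK => fx'.
  have := nrm_bi (f x') (f x).
  have : (1 + nrm y) * nrm (x' - x : C) <= (1 + nrm y) * d.
    by apply: ler_wpM2l => //; rewrite addr_ge0 ?nrm_ge0.
  by lra.
move=> [B0 [_ hB]]; exists (B0 + 1) => p; apply: hB.
by rewrite ltrDl.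
Qed.

(** The square is the continuous image of a product of two real segments. *)
Lemma compact_square (a : C) (r : R) :
  compact ([set (a + q.1%:C%C + I * q.2%:C%C : C) |
    q in (`[(- r), r] `*` `[(- r), r] : set (R * R))] : set (Cplx R)).
Proof.
apply: (@continuous_compact (R * R)%type (Cplx R)
  (fun q => a + q.1%:C%C + I * q.2%:C%C : C)); last first.
  by apply: compact_setX; exact: segment_compact.
apply: continuous_subspaceT => q.
apply/cvgrPdist_le => e' /complex_gt0[e e0 ->].
apply/(@nbhs_ballP R (R * R)%type); exists (e / 2) => /=; first by rewrite divr_gt0.
move=> q' [] /=; rewrite -!ball_normE /= => h1 h2.
rewrite norm_le (_ : _ - _ = (q.1 - q'.1)%:C%C + I * (q.2 - q'.2)%:C%C); last first.
  by rewrite !rmorphB/=; ring.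
by apply: (le_trans (nrmD _ _)); rewrite nrmM nrm_i mul1r !nrm_real; lra.
Qed.

Lemma open_compact_ball (Om : set (Cplx R)) (a : C) : open Om -> Om a ->
  exists rho : R, exists K : set (Cplx R),
    [/\ 0 < rho, compact K, K `<=` Om & forall p : C, nrm (p - a) <= 4 * rho -> K p].
Proof.
move=> oO Oa; have : nbhs (a : Cplx R) Om by apply: open_nbhs_nbhs.
move=> /nbhs_ballP[d' /= /complex_gt0[d d0 ->] dO].
(* With [rho = d / 16] the square of half-side [4 * rho] contains the disc of that radius and lies
   within [d / 2] of [a]. *)
pose r := 4 * (d / 16).
exists (d / 16), [set (a + q.1%:C%C + I * q.2%:C%C : C) |
  q in (`[(- r), r] `*` `[(- r), r] : set (R * R))]; split; last first.
- move=> p pa; exists (complex.Re (p - a), complex.Im (p - a)); last first.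
    by rewrite /= -addrA -complexE addrC subrK.
  have := Re_le_nrm (p - a); have := Im_le_nrm (p - a).
  by rewrite !ler_norml => /andP[i1 i2] /andP[r1 r2]; split;
    rewrite /= in_itv /=; apply/andP; split; rewrite /r; lra.
- move=> _ [q [+ +] <-]; rewrite /= !in_itv /= -!ler_norml => q1 q2.
  rewrite /r in q1 q2; apply: dO; rewrite -ball_normE /= [`|_|]normE ltcR nrmC.
  rewrite (_ : _ - a = q.1%:C%C + I * q.2%:C%C); last by ring.
  by apply: (le_lt_trans (nrmD _ _)); rewrite nrmM nrm_i mul1r !nrm_real; lra.
- exact: compact_square.
- by rewrite divr_gt0.
Qed.

End OperatorFunctions.

(** The elements of the space are exactly the functions [F(.) w], so they are quantified through
    [w]. *)
Theorem theorem3p2 (R : realType) (X : completeNormedModType R[i])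
  (ip : X -> X -> R[i]) (u : nat -> X) (Om : set (Cplx R)) (F : Cplx R -> X -> X) :
  is_inner_product ip ->
  is_orthonormal_basis ip u ->
  is_domain Om ->
  (forall z, Om z -> is_bounded_operator (F z)) ->
  ((forall w : X, analytic_on Om (fun z => F z w)) <->
   ((forall n : nat, analytic_on Om (fun z => F z (u n))) /\
    (forall K : set (Cplx R), compact K -> K `<=` Om ->
       exists M : R, forall z, K z -> opnorm_le (F z) M))).
Proof.
move=> ipP uP [_ [oO _]] bF; have Xc := @seq_complete_completeNormedMod R X.
split=> [anF|[anu bK] w a Oa].
  split=> [n|K cK KO]; first exact: anF.
  (* The family is indexed by the points of [K]; compactness supplies the pointwise bounds. *)
  have [|z Kz||M hM] := @uniform_boundedness R X X (Cplx R) K F Xc.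
  - by move=> z /KO /bF[linF _] c x y; exact: linF.
  - by have [_ [M /opnorm_leE hM]] := bF z (KO z Kz); exists M.
  - move=> w; apply: (compact_bounded_deriv K (fun z => F z w) cK) => p /KO Op.
    by apply/has_derivP; exact: anF.
  - by exists M => z Kz; apply/opnorm_leE; exact: hM.
have [rho [K [r0 cK KO aK]]] := open_compact_ball Om a oO Oa.
have [M0 hM0] := bK K cK KO.
pose M := `|M0|.
have hM z x : K z -> nrm (F z x) <= M * nrm x.
  move=> /hM0/opnorm_leE/(_ x)/le_trans; apply.
  by rewrite ler_wpM2r ?nrm_ge0 ?ler_norm.
have linF z x y : Om z -> F z (x + y) = F z x + F z y.
  by move=> /bF[linF _]; rewrite -[x]scale1r linF !scale1r.
have F0 z : Om z -> F z 0 = 0.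
  by move=> Oz; apply: (@addrI _ (F z 0)); rewrite -linF// !addr0.
have linZ z c x : Om z -> F z (c *: x) = c *: F z x.
  by move=> Oz; have [lF _] := bF z Oz; rewrite -[c *: x]addr0 lF F0// addr0.
have linB z x y : Om z -> F z (x - y) = F z x - F z y.
  by move=> Oz; rewrite linF// -scaleN1r linZ// scaleN1r.
(* Written as a sum of the functions [F z (u k)], so that differentiability follows by induction on
   [n]; on [Om], linearity identifies it with [F z] of the partial sum. *)
pose f_ n (z : R[i]) : X := \sum_(k < n) ip w (u k) *: F z (u k).
have f_E n z : Om z -> f_ n z = F z (fourier_sum ip u w n).
  move=> Oz; elim: n => [|n IH]; first by rewrite /f_ big_ord0 fourier_sum0 F0.
  by rewrite /f_ big_ord_recr/= fourier_sumS linF// linZ// -IH.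
apply/has_derivP.
(* On [K] the error is [|F z (S_n - w)| <= M * |S_n - w|], uniformly in [z]. *)
apply: (@has_deriv_uniform_limit R X f_ (fun n => M * nrm (fourier_sum ip u w n - w))
  (fun z => F z w) a rho (M * nrm w)) => //.
- move=> e e0; have M1 : 0 < M + 1 by rewrite ltr_wpDl /M.
  have [N hN] := fourier_sum_lim ip u ipP uP w Xc (e / (M + 1)) ltac:(by rewrite divr_gt0).
  exists N => n /hN h.
  apply: (@le_trans _ _ ((M + 1) * (e / (M + 1)))).
    by apply: ler_pM => //; rewrite ?nrm_ge0 ?lerDl// /M.
  by rewrite mulrC divfK// gt_eqF.
- move=> n p /aK/KO Op; elim: n => [|n [y IH]].
    by exists 0; rewrite (_ : f_ 0%N = fun=> 0); [exact: has_deriv_cst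
      | apply/funext => z; rewrite /f_ big_ord0].
  have /has_derivP[y' hy'] := anu n p Op.
  exists (y + ip w (u n) *: y').
  rewrite (_ : f_ n.+1 = fun z => f_ n z + ip w (u n) *: F z (u n)).
    by apply: has_derivD => //; exact: has_derivZ.
  by apply/funext => z; rewrite /f_ big_ord_recr.
- by move=> n p /aK Kp; rewrite f_E ?linB; [|exact: KO..]; rewrite -linB; [exact: hM|exact: KO].
- by move=> p /aK Kp; exact: hM.
Qed.
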